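(* Let $d$ be a natural number and assume that the order in $\mathrm{Cones}(d)$ is the inclusion order, i.e. that for all cones $C\subsetneq D$ in $\mathbb R^d$ one has $C<D$ in $\mathrm{Cones}(d)$. Then: (a) the spaces $|\mathrm{Cones}(d)|$, $|\mathrm{Cones}^+(d)|$, and $|\mathrm{Cones}^+(d)\setminus\{0\}|$ are contractible; (b) $|\mathrm{Cones}(d)\setminus\{0\}|$ is a filtered union of spaces, each containing a $(d-1)$-sphere as a strong deformation retract.
   Context: A cone in $\mathbb R^d$ means a pointed, rational, polyhedral cone, i.e. a set $C=\mathbb R_+x_1+\cdots+\mathbb R_+x_n$ with $x_1,\ldots,x_n\in\mathbb Z^d$ such that there is no nonzero $x\in C$ with $-x\in C$; the zero cone $0=\{0\}$ is included. Here $\mathbb R_+$ and $\mathbb Z_+$ denote the nonnegative reals and nonnegative integers. For $X\subset\mathbb R^d$ put $\mathsf L(X)=X\cap\mathbb Z^d$. $\mathrm{Cones}(d)$ is the set of all cones in $\mathbb R^d$, made into a poset as follows: $C<D$ if and only if there is a finite sequence of cones $C=C_0\subset C_1\subset\cdots\subset C_n=D$ in $\mathbb R^d$, with $n\ge 1$, such that for each $i=1,\ldots,n$ there is $x\in C_i\setminus C_{i-1}$ with $\mathsf L(C_i)=\mathsf L(C_{i-1})+\mathbb Z_+x$. $\mathrm{Cones}^+(d)$ is the subposet of $\mathrm{Cones}(d)$ (with the induced order) consisting of the cones contained in $(\mathbb R^{d-1}\times\mathbb R_{>0})\cup\{0\}$. For a poset $\Pi$, $|\Pi|$ denotes the geometric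 realization of its order complex, i.e. of the (possibly infinite) simplicial complex whose simplices are the finite nonempty chains in $\Pi$. *)

(* Defs.v *)
From HB Require Import structures.
From mathcomp Require Import all_boot all_order all_algebra.
From mathcomp Require Import all_classical all_reals all_analysis.
Import Order.TTheory GRing.Theory Num.Theory.
Import numFieldNormedType.Exports.

Set Implicit Arguments.
Unset Strict Implicit.
Unset Printing Implicit Defensive.

Local Open Scope classical_set_scope.
Local Open Scope ring_scope.

Section Cones.
Variables (R : realType) (d : nat).
Implicit Types (A : set 'rV[R]_d).

Definition integral_points : set 'rV[R]_d :=
  [set x | forall i, x ord0 i \is a Num.int].

Definition lattice_points A : set 'rV[R]_d := A `&` integral_points.

Definition conic_hull n (x : 'I_n -> 'rV[R]_d) : set 'rV[R]_d :=
  [set y | exists2 a : 'I_n -> R,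
     forall i, 0 <= a i & y = \sum_(i < n) a i *: x i].

Definition pointed A : Prop := forall x, A x -> A (- x) -> x = 0.

(* [n = 0] is allowed and gives the zero cone *)
Definition is_cone A : Prop :=
  (exists n (x : 'I_n -> 'rV[R]_d),
     (forall i, integral_points (x i)) /\ A = conic_hull x) /\
  pointed A.

Record cone := Cone { cone_set :> set 'rV[R]_d; coneP : is_cone cone_set }.

HB.instance Definition _ := gen_eqMixin cone.
HB.instance Definition _ := gen_choiceMixin cone.

Fact zero_cone_subproof : is_cone [set 0].
Proof.
split; last by move=> x.
exists 0%N, (fun=> 0); split; first by case.
apply/seteqP; split=> [x ->|x [a _ ->]] /=; last by rewrite big_ord0.
by exists (fun=> 0); [case | rewrite big_ord0].
Qed.

Definition zero_cone := Cone zero_cone_subproof.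

Definition elementary_extension (C D : cone) : Prop :=
  cone_set C `<=` cone_set D /\
  exists2 x, (cone_set D `\` cone_set C) x &
    lattice_points D =
      [set u + x *+ k | u in lattice_points C & k in [set: nat]].

Definition cone_lt (C D : cone) : Prop :=
  exists n (c : nat -> cone),
    [/\ (0 < n)%N, c 0%N = C, c n = D &
        forall i, (i < n)%N -> elementary_extension (c i) (c i.+1)].

Lemma cone_lt_proper C D :
  cone_lt C D -> cone_set C `<=` cone_set D /\ ~ (cone_set D `<=` cone_set C).
Proof.
case=> [[|n] [c []//]] _ <- <- cS.
have c1 m : (m <= n)%N -> cone_set (c 1%N) `<=` cone_set (c m.+1).
  elim: m => [_ y //|m IHm mn y /(IHm (ltnW mn))].
  by have [+ _] := cS m.+1 mn; exact.
have [c01 [x [c1x c0x] _]] := cS 0%N isT.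
split; first by move=> y /c01; exact: c1.
by move=> c10; apply: c0x; apply: c10; exact: c1 c1x.
Qed.

Lemma cone_lt_irr : irreflexive (fun C D => `[< cone_lt C D >]).
Proof. by move=> C; apply/asboolP => /cone_lt_proper[_]; apply. Qed.

Lemma cone_lt_trans : transitive (fun C D => `[< cone_lt C D >]).
Proof.
move=> D C E /asboolP[n [c [n0 c0 cn cS]]] /asboolP[m [e [m0 e0 em eS]]].
apply/asboolP; exists (n + m)%N.
exists (fun i => if (i <= n)%N then c i else e (i - n)%N); split => //=.
- by rewrite addn_gt0 n0.
- by rewrite -[X in (_ <= X)%N]addn0 leq_add2l leqNgt m0 addKn.
- move=> i inm; have [lin|lni|->] := ltngtP i n.
  + exact: cS.
  + by rewrite subSn 1?ltnW//; apply: eS; rewrite ltn_subLR// ltnW.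
  + by rewrite subSnn cn -e0; exact: eS.
Qed.

Fact cone_display : Order.disp_t. Proof. exact: Order.Disp tt tt. Qed.

HB.instance Definition _ := @Order.Lt_isPOrder.Build cone_display cone
  (fun C D => `[< cone_lt C D >]) cone_lt_irr cone_lt_trans.

Definition Cones : set cone := setT.

(* the index of the last coordinate is the only [i] with [i.+1 = d] *)
Definition Cones_pos : set cone :=
  [set C | forall x, cone_set C x ->
     (forall i : 'I_d, i.+1 = d -> 0 < x ord0 i) \/ x = 0].

End Cones.

Arguments zero_cone : clear implicits.
Arguments Cones : clear implicits.
Arguments Cones_pos : clear implicits.

(* The realization |S| of the order complex of a subset S of a poset (with the
   induced order): a point is given by its barycentric coordinates, which are
   carried by a simplex of the order complex. *)
Section Realization.
Variables (R : realType) (disp : Order.disp_t) (P : porderType disp).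
Variable S : set P.

Definition simplex (s : set P) : Prop :=
  [/\ s !=set0, finite_set s, s `<=` S &
      forall p q, s p -> s q -> (p >=< q)%O].

Record realization := Realization {
  bary :> P -> R;
  bary_ge0 : forall p, 0 <= bary p;
  bary_simplex : simplex [set p | bary p != 0];
  bary_sum1 : \sum_(p \in [set: P]) bary p = 1 }.

HB.instance Definition _ := gen_eqMixin realization.
HB.instance Definition _ := gen_choiceMixin realization.

Definition closed_simplex (s : set P) : set realization :=
  [set x | forall p, bary x p != 0 -> s p].

(* weak topology: U is open iff its trace on every closed simplex is open for
   the Euclidean topology, given here by the sup distance of coordinates *)
Definition weak_open (U : set realization) : Prop :=
  forall s, simplex s -> forall x, (U `&` closed_simplex s) x ->
    exists2 e : R, 0 < e & forall y, closed_simplex s y ->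
      (forall p, `|bary x p - bary y p| < e) -> U y.

Lemma weak_openT : weak_open setT.
Proof. by move=> s _ x _; exists 1. Qed.

Lemma weak_openI : setI_closed weak_open.
Proof.
move=> U V oU oV s ss x [[Ux Vx] sx].
have [e e0 eU] := oU s ss x (conj Ux sx).
have [f f0 fV] := oV s ss x (conj Vx sx).
exists (Num.min e f); first by rewrite lt_min e0.
move=> y sy xy; split; [apply: eU | apply: fV] => // p;
  by have := xy p; rewrite lt_min => /andP[].
Qed.

Lemma weak_open_bigU (I : Type) (f : I -> set realization) :
  (forall i, weak_open (f i)) -> weak_open (\bigcup_i f i).
Proof.
move=> fo s ss x [[i _ fix_] sx]; have [e e0 ef] := fo i s ss x (conj fix_ sx).
by exists e => // y sy xy; exists i => //; exact: ef.
Qed.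

HB.instance Definition _ :=
  isOpenTopological.Build realization weak_openT weak_openI weak_open_bigU.

End Realization.

Section Topology.
Variable R : realType.
Implicit Types T : topologicalType.

Definition homeomorphic (T U : topologicalType) : Prop :=
  exists (f : T -> U) (g : U -> T),
    [/\ continuous f, continuous g, cancel f g & cancel g f].

(* homotopies are only meaningful on [T * `[0, 1]] *)
Definition homotopy_on T (H : T * R -> T) : Prop :=
  {within [set: T] `*` `[0, 1], continuous H}.

Definition contractible T : Prop :=
  exists (x0 : T) (H : T * R -> T),
    [/\ homotopy_on H, forall x, H (x, 0) = x & forall x, H (x, 1) = x0].

Definition strong_deformation_retract T (A : set T) : Prop :=
  exists H : T * R -> T,
    [/\ homotopy_on H, forall x, H (x, 0) = x, forall x, A (H (x, 1)) &
        forall a t, A a -> 0 <= t <= 1 -> H (a, t) = a].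

(* the unit sphere of R^d, of dimension d - 1 *)
Definition unit_sphere d : set 'rV[R]_d :=
  [set x | \sum_(i < d) x ord0 i ^+ 2 = 1].

(* T is the union of the directed family F of its subspaces, with the topology
   of the union (the colimit topology) *)
Definition filtered_union T (F : set (set T)) : Prop :=
  [/\ F !=set0,
      forall X Y, F X -> F Y -> exists2 Z, F Z & X `|` Y `<=` Z,
      \bigcup_(X in F) X = [set: T] &
      forall U : set T,
        (forall X, F X -> open (set_val @^-1` U : set (set_type X))) -> open U].

End Topology.

Arguments unit_sphere : clear implicits.

(* Main.v *)
Require Import Defs.
From mathcomp Require Import all_boot all_order all_algebra finmap ring lra.
From mathcomp Require Import all_classical all_reals all_analysis.
Import Order.TTheory GRing.Theory Num.Theory.
Import numFieldNormedType.Exports.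
Local Open Scope classical_set_scope.
Local Open Scope ring_scope.

(** Points of a realization are finitely supported weights on a chain, and all
    the homotopies below are written as explicit formulas in these weights.
    Such a formula is continuous as soon as its coordinates are continuous on
    each closed simplex times [0, 1]: near a given time the tube lemma turns
    the simplexwise condition into one for the weak topology
    ([homotopy_continuous]).  [transport_deforms] packages this: the weight of
    each vertex is split into pieces, piece k of vertex p is moved to h k p,
    and the result is normalized.

    Three moves suffice.  A poset with a minimum is deformed to that minimum by
    a straight line ([cone_point_deforms]).  A closure operator f deforms the
    realization to that of the fixed points ([closure_deforms]).  Finally
    [cut_deforms] removes the elements that cross a wall: cones C that have
    points strictly on both sides of a coordinate hyperplane.  Such a C
    contains its two closed halves and its trace on the hyperplane, and the
    trace is not the zero cone because C is pointed.

    With the inclusion order the zero cone is the minimum of all cones and of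
    the positive cones.  For the nonzero positive cones, adding a fixed
    vertical ray is a closure operator whose fixed points have that ray as
    their minimum; hence these three spaces are contractible.

    For the nonzero cones, cutting successively by the d coordinate hyperplanes
    deforms the realization to that of the cones contained in some coordinate
    orthant, and sending such a cone to the smallest face of an orthant that
    contains it is a closure operator.  The realization of the nonzero orthant
    faces, indexed by nonzero sign vectors, is the barycentric subdivision of
    the boundary of the cross-polytope, that is, a (d-1)-sphere
    ([orthants_sphere]).  So the whole space already contains a sphere as a
    strong deformation retract, and it is the filtered union of the family
    whose only member is itself. *)

Set Implicit Arguments.
Unset Strict Implicit.
Unset Printing Implicit Defensive.

(** * Sums over finite supports *)

Section FiniteSums.
Variables (R : realType) (P : choiceType).

Lemma finite_pos_lb (I : choiceType) (A : set I) (e : I -> R) : finite_set A ->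
  (forall i, 0 < e i) -> exists2 d : R, 0 < d & forall i, A i -> d <= e i.
Proof.
move=> fA e0; exists (\big[Num.min/1]_(i <- fset_set A) e i).
  by elim/big_ind: _ => // a b a0 b0; rewrite lt_min a0.
by move=> i Ai; apply: ge_bigmin_seq; rewrite // in_fset_set// inE.
Qed.

Lemma finite_powerset (A : set P) : finite_set A -> finite_set [set s | s `<=` A].
Proof.
move=> fA.
apply: (@sub_finite_set _ _ ((fun Y : {fset P} => [set` Y]) @`
    [set` fpowerset (fset_set A)])); last first.
  exact/finite_image/finite_fset.
move=> s /= sA; have fs : finite_set s by exact: sub_finite_set fA.
exists (fset_set s); last by rewrite fset_setK.
by rewrite /= fpowersetE; apply/fsubsetP => p; rewrite !in_fset_set// !inE; exact: sA.
Qed.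

Lemma fsumTE (s : set P) (f : P -> R) : finite_set s ->
  (forall p, ~ s p -> f p = 0) ->
  \sum_(p \in [set: P]) f p = \sum_(p <- fset_set s) f p.
Proof.
move=> fs f0; rewrite (fsbigTE (fset_set s))// => p.
by rewrite in_fset_set// notin_setE => /f0.
Qed.

Lemma fsum_le (f : P -> R) p :
  finite_set [set q | f q != 0] -> (forall q, 0 <= f q) ->
  f p <= \sum_(q \in [set: P]) f q.
Proof.
move=> ff f0; have fs : finite_set ([set q | f q != 0] `|` [set p]).
  by rewrite finite_setU; split=> //; exact: finite_set1.
rewrite (@fsumTE ([set q | f q != 0] `|` [set p]))//.
  rewrite (big_fsetD1 p) /=; first by rewrite lerDl sumr_ge0.
  by rewrite in_fset_set// inE; right.
by move=> q /not_orP[+ _]; move/negP; rewrite negbK => /eqP.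
Qed.

Lemma cvg_fsum (U : Type) (F : set_system U) (FF : Filter F) (s : set P)
    (f : U -> P -> R) (l : P -> R) : finite_set s ->
  (forall p, ~ s p -> l p = 0) ->
  (\forall z \near F, forall p, ~ s p -> f z p = 0) ->
  (forall p, f z p @[z --> F] --> l p) ->
  \sum_(p \in [set: P]) f z p @[z --> F] --> \sum_(p \in [set: P]) l p.
Proof.
move=> fs l0 f0 fl; rewrite (fsumTE fs l0).
apply: (@cvg_trans _ ((fun z => \sum_(p <- fset_set s) f z p) @ F)).
  apply: near_eq_cvg; near=> z; rewrite (fsumTE fs)//.
  by near: z.
apply: cvg_big => [|p _]; last exact: fl.
by move=> z; apply: cvgD; [exact: cvg_fst | exact: cvg_snd].
Unshelve. all: by end_near. Qed.

End FiniteSums.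

(** * Neighbourhoods in the weak topology *)

Section Realizations.
Variables (R : realType) (disp : Order.disp_t) (P : porderType disp).
Variable S : set P.
Notation T := (realization R S).
Implicit Types (x y : T) (s V : set P).

Definition supp (w : P -> R) : set P := [set p | w p != 0].

Lemma suppN (w : P -> R) p : ~ supp w p -> w p = 0.
Proof. by move/negP; rewrite negbK => /eqP. Qed.

Lemma realization_eq x y : (forall p, x p = y p) -> x = y.
Proof.
case: x y => [x x0 xs x1] [y y0 ys y1] /= xy.
have {}xy : x = y by exact/funext.
by subst y; congr Realization; exact: Prop_irrelevance.
Qed.

Lemma finite_supp x : finite_set (supp x).
Proof. by have [] := bary_simplex x. Qed.

Lemma supp_comparable x p q : supp x p -> supp x q -> (p >=< q)%O.
Proof. by have [_ _ _] := bary_simplex x; apply. Qed.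

(** On points supported in a fixed finite set of vertices the weak topology is
    no finer than that of the sup distance of coordinates: only finitely many
    simplices are involved, and a nearby point keeps all the vertices of [x] in
    its support, so it lies in a common closed simplex with [x]. *)
Lemma weak_nbhs V x (U : set T) : finite_set V -> nbhs x U ->
  exists2 e : R, 0 < e & forall y, closed_simplex V y ->
    (forall p, `|x p - y p| < e) -> U y.
Proof.
move=> finV; rewrite nbhsE => -[G [oG Gx] GU].
pose good s := simplex S s /\ supp x `<=` s.
have loc s : exists e : R, 0 < e /\ (good s -> forall y, closed_simplex s y ->
    (forall p, `|x p - y p| < e) -> G y).
  have [[ss xs]|ngs] := pselect (good s); last by exists 1.
  have sx : closed_simplex s x by move=> p xp; exact: xs.
  by have [e e0 eG] := oG s ss x (conj Gx sx); exists e.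
have [e eP] := choice loc.
have [e1 e10 e1P] := finite_pos_lb (finite_powerset finV) (fun s => (eP s).1).
pose m p := if p \in supp x then x p else 1.
have m0 p : 0 < m p.
  rewrite /m; case: ifPn => // /set_mem xp.
  by rewrite lt_def xp bary_ge0.
have [e2 e20 e2P] := finite_pos_lb (finite_supp x) m0.
exists (Num.min e1 e2); first by rewrite lt_min e10.
move=> y Vy xy; apply: GU.
apply: ((eP (supp y)).2 _ y) => //.
  split; first exact: bary_simplex.
  move=> p xp; have := xy p; rewrite lt_min => /andP[_ xyp].
  apply/eqP => yp; move: xyp; rewrite yp subr0 ger0_norm ?bary_ge0// ltNge.
  by move/negP; apply; have := e2P _ xp; rewrite /m mem_set.
move=> p; apply: lt_le_trans (xy p) _.
rewrite ge_min; apply/orP; left; apply: e1P => q; exact: Vy.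
Qed.

End Realizations.

Section Homotopies.
Variables (R : realType) (disp : Order.disp_t) (P : porderType disp).
Variable S : set P.
Notation T := (realization R S).
Implicit Types (x y : T) (s V : set P).

(** The form in which [weak_nbhs] is used: a map with values in a finite
    subcomplex converges when its coordinates do. *)
Lemma cvg_realization (U : Type) (F : set_system U) (FF : Filter F)
    (V : set P) (h : U -> T) x : finite_set V ->
  (\forall z \near F, closed_simplex V (h z)) ->
  (forall p, h z p @[z --> F] --> x p) -> closed_simplex V x ->
  h @ F --> x.
Proof.
move=> finV hV hx xV A /(weak_nbhs finV)[e e0 eA].
have : \forall z \near F, forall p, V p -> `|x p - h z p| < e.
  have /finite_fsetP[X VX] := finV.
  have : F (\bigcap_(p in [set` X]) [set z | `|x p - h z p| < e]).
    by apply: filter_bigI => p _; move/cvgrPdist_lt : (hx p); exact.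
  by rewrite -VX; apply: filterS => z zX p; exact: zX.
move: hV; apply: filterS2 => z zV zx; apply: eA => // p.
have [Vp|nVp] := pselect (V p); first exact: zx.
suff [-> ->] : x p = 0 /\ h z p = 0 by rewrite subr0 normr0.
by split; apply: suppN => /= ?; apply: nVp; [exact: xV|exact: zV].
Qed.

(** The traces on the closed simplex [s] of the neighbourhoods of [x], as a
    filter on the whole realization; this makes the limit lemmas for real
    valued functions available for formulas in barycentric coordinates. *)
Definition simplex_nbhs s x : set_system T :=
  filter_from [set e : R | 0 < e]
    (fun e => [set y | closed_simplex s y /\ forall p, `|x p - y p| < e]).

Global Instance simplex_nbhs_filter s x : Filter (simplex_nbhs s x).
Proof.
apply: filter_from_filter; first by exists 1 => /=.
move=> e f /= e0 f0; exists (Num.min e f) => /=; first by rewrite lt_min e0.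
move=> y [sy xy]; split; split=> // p; have := xy p;
  by rewrite lt_min => /andP[].
Qed.

Lemma simplex_nbhs_closed s x : \forall y \near simplex_nbhs s x, closed_simplex s y.
Proof. by exists 1 => //= y []. Qed.

Lemma simplex_nbhs_bary s x p : bary y p @[y --> simplex_nbhs s x] --> x p.
Proof.
by apply/cvgrPdist_lt => e e0; exists e => //= y [_ /(_ p)].
Qed.

Definition unit_nbhs (t : R) := within `[0, 1]%classic (nbhs t).

Definition prism_nbhs s (x : T) t := filter_prod (simplex_nbhs s x) (unit_nbhs t).

Lemma bary_continuous p : continuous (fun x : T => x p).
Proof.
move=> x; apply/(@cvgrPdist_lt _ _ _ _ (nbhs_filter x)) => e e0.
have oB : open [set y : T | `|x p - y p| < e].
  move=> s ss y [/= yxe sy]; exists (e - `|x p - y p|); first by rewrite subr_gt0.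
  move=> z sz /(_ p) yz; rewrite /= -(subrKA (y p)) (le_lt_trans (ler_normD _ _))//.
  by rewrite -ltrBrDl.
suff : nbhs x [set y : T | `|x p - y p| < e] by [].
by apply: open_nbhs_nbhs; split=> //=; rewrite subrr normr0.
Qed.

(** Continuity on the product with [0, 1] may be checked simplex by simplex.
    The product of the weak topology with an interval is still coherent with
    the simplices because the interval is locally compact: around [(x0, t0)] a
    compact interval [J] of times is kept inside the open set [W], and the set
    of points that stay in [W] during [J] is weakly open by the tube lemma. *)
Lemma homotopy_continuous (S' : set P) (H : T * R -> T) :
  (forall s x t, simplex S s -> s `<=` S' -> closed_simplex s x -> 0 <= t <= 1 ->
     H z @[z --> prism_nbhs s x t] --> H (x, t)) ->
  {within closed_simplex S' `*` `[0, 1], continuous H}.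
Proof.
move=> Hc; apply/subspace_continuousP => -[x0 t0] [/= x0S' t01] U HU.
move: (t01); rewrite in_itv/= => {}t01.
have HU' := HU; move: HU'; rewrite nbhsE => -[W [oW Wx] WU].
have x0s : closed_simplex (supp x0) x0 by [].
have := Hc _ _ _ (bary_simplex x0) x0S' x0s t01 _ (open_nbhs_nbhs (conj oW Wx)).
case=> -[A B] [/= [e e0 eA] [d /= d0 dB]] ABW.
pose J := `[t0 - d / 2, t0 + d / 2]%classic.
pose G1 := [set x : T | closed_simplex S' x ->
  forall t, J t -> 0 <= t <= 1 -> W (H (x, t))].
have G1x0 : G1 x0.
  move=> _ t; rewrite /J /mkset in_itv/= => /andP[t1 t2] t01'.
  apply: (ABW (x0, t)); split=> /=.
    by apply: eA; split=> // p; rewrite subrr normr0.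
  apply: dB => /=; last by [].
  have d2 : d / 2 < d by rewrite gtr_pMr // invf_lt1 // ltr1n.
  by rewrite ltr_distlC; apply/andP; split;
   [rewrite (lt_le_trans _ t1)// ltrD2l ltrN2|rewrite (le_lt_trans t2)// ltrD2l].
(* points outside the closed subcomplex have a neighbourhood outside it, and
   for the others the tube lemma applies in the face of s spanned by S' *)
have oG1 : open G1.
  move=> s ss x [G1x sx].
  have [xS'|/existsNP[p /not_implyP[xp nS'p]]] := pselect (closed_simplex S' x);
    last first.
    exists `|x p|; first by rewrite normr_gt0.
    move=> y sy /(_ p) xy yS'.
    by exfalso; apply/nS'p/yS'; apply: contraTneq xy => ->; rewrite subr0 ltxx.
  have xsS' : closed_simplex (s `&` S') x by move=> p xp; split; [exact: sx|exact: xS'].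
  have ssS' : simplex S (s `&` S').
    have [_ fs sS cs] := ss.
    have [[p xp] _ _ _] := bary_simplex x.
    split; first by exists p; exact: xsS'.
    - by apply: sub_finite_set fs => ? [].
    - by move=> ? [/sS].
    - by move=> ? ? [? _] [? _]; exact: cs.
  have cJ : compact J by exact: segment_compact.
  have := (compact_near_coveringP J).1 cJ T (simplex_nbhs (s `&` S') x)
    (fun y t => 0 <= t <= 1 -> W (H (y, t))) _.
  case.
    move=> t Jt.
    have [t01'|t01'] := boolP (0 <= t <= 1); last first.
      have : open [set t : R | ~ (0 <= t <= 1)].
        rewrite (_ : [set t | _] = ~` `[0, 1]%classic); last first.
          by apply/seteqP; split=> z /=; rewrite in_itv/=.
        exact/closed_openC/interval_closed.
      move=> oC; exists (~` `[0, 1]%classic, setT) => /=; last first.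
        by move=> [t' y] [/= + _]; rewrite in_itv.
      split; last exact: filterT.
      have nt : (~` `[0, 1]%classic) t by rewrite /setC /mkset in_itv/=; exact/negP.
      exact: (open_nbhs_nbhs (conj oC nt)).
    have nW : nbhs (H (x, t)) W := open_nbhs_nbhs (conj oW (G1x xS' t Jt t01')).
    have sS' : s `&` S' `<=` S' by move=> ? [].
    have [[A1 B1] [/= A1x B1t] ABW1] := Hc _ _ _ ssS' sS' xsS' t01' W nW.
    have nB : nbhs t [set z : R | 0 <= z <= 1 -> B1 z].
      have B1t' : \forall z \near t, `[0, 1]%classic z -> B1 z by exact: B1t.
      by apply: filterS B1t' => z zB z01; apply: zB; rewrite /= in_itv.
    exists ([set t | 0 <= t <= 1 -> B1 t], A1); first by split; [exact: nB|exact: A1x].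
    by move=> [t' y] [/= B1t' A1y] t'01; exact: (ABW1 (y, t') (conj A1y (B1t' t'01))).
  move=> e1 e10 e1P; exists e1 => // y sy xy yS' t Jt t01'; apply: e1P => //; split=> // p yp.
  by split; [exact: sy|exact: yS'].
exists (G1, ball t0 (d / 2)).
  split=> /=; first by apply: open_nbhs_nbhs; split.
  by apply: nbhsx_ballx; rewrite divr_gt0.
move=> [x t] [/= G1x t0t] [/= xS' t01']; apply: WU; apply: G1x => //.
move: t0t; rewrite /ball /= /J /= in_itv /= ltr_distlC => /andP[/ltW -> /ltW ->] //.
Qed.

End Homotopies.

(** * Deformations of a topological space *)

Section Deformation.
Variables (R : realType) (T : topologicalType).
Implicit Types (X A B : set T).

(** Strong deformation of [X] to [A] inside an ambient space, by a map that is
    only constrained over [X]; with a common ambient space such deformations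
    compose. *)
Definition deforms X A := exists H : T * R -> T,
  [/\ {within X `*` `[0, 1], continuous H},
      forall x, X x -> H (x, 0) = x,
      forall x t, X x -> 0 <= t <= 1 -> X (H (x, t)),
      forall x, X x -> A (H (x, 1)) &
      A `<=` X /\ forall a t, A a -> 0 <= t <= 1 -> H (a, t) = a].

Lemma within_comp (U V W : topologicalType) (D : set U) (E : set V)
    (g : U -> V) (f : V -> W) (u : U) (l : W) :
  (forall z, D z -> E (g z)) ->
  g z @[z --> within D (nbhs u)] --> g u ->
  f z @[z --> within E (nbhs (g u))] --> l ->
  f (g z) @[z --> within D (nbhs u)] --> l.
Proof.
move=> DE gu fl N Nl.
have := gu _ (fl _ Nl); apply: filterS2 (withinT D _) => z Dz /=; apply.
exact: DE.
Qed.

Lemma cvg_pairT (I : Type) (F : set_system I) (FF : Filter F)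
    (U V : topologicalType) (f : I -> U) (g : I -> V) (a : U) (b : V) :
  f z @[z --> F] --> a -> g z @[z --> F] --> b ->
  (f z, g z) @[z --> F] --> (a, b).
Proof. by move=> fa gb; exact: cvg_pair. Qed.

(** Run the first deformation at double speed, then the second one. *)
Lemma deforms_trans X A B : deforms X A -> deforms A B -> deforms X B.
Proof.
move=> [H1 [c1 s1 i1 e1 [AX f1]]] [H2 [c2 s2 i2 e2 [BA f2]]].
pose h1 (z : T * R) := (z.1, 2 * z.2).
pose h2 (z : T * R) := (H1 (z.1, 1), 2 * z.2 - 1).
pose H z := if z.2 <= 1 / 2 then H1 (h1 z) else H2 (h2 z).
have dbl (t : R) : 0 <= t <= 1 / 2 -> 0 <= 2 * t <= 1 by lra.
have dbl' (t : R) : 1 / 2 <= t <= 1 -> 0 <= 2 * t - 1 <= 1 by lra.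
have Hl x t : 0 <= t <= 1 -> t <= 1 / 2 -> H (x, t) = H1 (x, 2 * t).
  by rewrite /H /= => _ ->.
have Hr x t : X x -> 0 <= t <= 1 -> 1 / 2 <= t -> H (x, t) = H2 (H1 (x, 1), 2 * t - 1).
  rewrite /H /h1 /h2 /= => Xx t01 t2; case: ifPn => // t2'.
  have -> : t = 1 / 2 by apply/eqP; rewrite eq_le t2 t2'.
  by rewrite mul1r divff ?pnatr_eq0// subrr s2//; exact: e1.
exists H; split.
- apply/subspace_continuousP => -[x t] [/= Xx]; rewrite in_itv/= => t01.
  have cl : t <= 1 / 2 -> H1 (h1 z) @[z --> within (X `*` `[0, 1 / 2]) (nbhs (x, t))]
      --> H1 (h1 (x, t)).
    move=> t2; apply: (@within_comp (T * R)%type (T * R)%type T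
      (X `*` `[0, 1 / 2]) (X `*` `[0, 1]) h1 H1 (x, t) (H1 (h1 (x, t)))).
    - by move=> [y u] [/= Xy]; rewrite !in_itv/= => /dbl.
    - apply: cvg_within_filter; apply: cvg_pairT; first exact: cvg_fst.
      by apply: cvgM; [exact: cvg_cst|exact: cvg_snd].
    - move/subspace_continuousP : c1; apply; split=> //=; rewrite in_itv/=; apply: dbl.
      by move: t01 => /andP[-> _].
  have cr : 1 / 2 <= t -> H2 (h2 z) @[z --> within (X `*` `[1 / 2, 1]) (nbhs (x, t))]
      --> H2 (h2 (x, t)).
    move=> t2; apply: (@within_comp (T * R)%type (T * R)%type T
      (X `*` `[1 / 2, 1]) (A `*` `[0, 1]) h2 H2 (x, t) (H2 (h2 (x, t)))).
    - move=> [y u] [/= Xy]; rewrite !in_itv/= => /dbl' u01.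
      by split=> //=; exact: e1.
    - apply: cvg_pairT.
        apply: (@within_comp (T * R)%type (T * R)%type T
          (X `*` `[1 / 2, 1]) (X `*` `[0, 1]) (fun z => (z.1, 1)) H1 (x, t) (H1 (x, 1))).
        + by move=> [y u] [/= Xy _]; split=> //=; rewrite in_itv/= ler01 lexx.
        + apply: cvg_within_filter; apply: cvg_pairT; [exact: cvg_fst|exact: cvg_cst].
        + move/subspace_continuousP : c1; apply; split=> //=.
          by rewrite in_itv/= ler01 lexx.
      apply: cvg_within_filter; apply: cvgB; last exact: cvg_cst.
      by apply: cvgM; [exact: cvg_cst|exact: cvg_snd].
    - move/subspace_continuousP : c2; apply; split=> /=; first exact: e1.
      by rewrite in_itv/=; apply: dbl'; move: t01 => /andP[_ ->]; rewrite andbT.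
  move=> U HU'; have HU : nbhs (H (x, t)) U := HU'.
  have nl : \forall z \near (x, t), X z.1 -> 0 <= z.2 <= 1 / 2 -> U (H1 (h1 z)).
    have [t2|t2] := leP t (1 / 2).
      rewrite Hl// in HU; have cU : \forall z \near (x, t),
        (X `*` `[0, 1 / 2]) z -> U (H1 (h1 z)) by exact: cl HU.
      apply: filterS cU => -[y u] /= Uyu Xy u2.
      by apply: Uyu; split=> //=; rewrite in_itv.
    have : \forall z \near (x, t), 1 / 2 < z.2.
      have : \forall u \near t, 1 / 2 < u by exact: lt_nbhsr.
      exact: (@cvg_snd _ _ (nbhs x) (nbhs t)).
    by apply: filterS => z z2 _ /andP[_]; rewrite leNgt z2.
  have nr : \forall z \near (x, t), X z.1 -> 1 / 2 <= z.2 <= 1 -> U (H2 (h2 z)).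
    have [t2|t2] := leP (1 / 2) t.
      rewrite Hr// in HU; have cU : \forall z \near (x, t),
        (X `*` `[1 / 2, 1]) z -> U (H2 (h2 z)) by exact: cr HU.
      apply: filterS cU => -[y u] /= Uyu Xy u2.
      by apply: Uyu; split=> //=; rewrite in_itv.
    have : \forall z \near (x, t), z.2 < 1 / 2.
      have : \forall u \near t, u < 1 / 2 by exact: lt_nbhsl.
      exact: (@cvg_snd _ _ (nbhs x) (nbhs t)).
    by apply: filterS => z z2 _ /andP[+ _]; rewrite leNgt z2.
  have : \forall z \near (x, t), (X `*` `[0, 1]) z -> U (H z).
    apply: filterS2 nl nr => z zl zr [Xz]; rewrite /= in_itv/= => /andP[z0 z1].
    rewrite /H; case: ifPn => [z2|]; last rewrite -ltNge => /ltW z2.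
      by apply: zl => //; rewrite z0.
    by apply: zr => //; rewrite z1 andbT.
  exact.
- by move=> x Xx; rewrite Hl ?mulr0 ?s1 ?lexx ?ler01// divr_ge0.
- move=> x t Xx t01; have [t2|/ltW t2] := leP t (1 / 2).
    by rewrite Hl//; apply: i1 => //; apply: dbl; move: t01 => /andP[-> _].
  rewrite Hr//; apply/AX/i2; first exact: e1.
  by apply: dbl'; move: t01 => /andP[_ ->]; rewrite andbT.
- move=> x Xx; rewrite Hr//; [|by rewrite ler01 lexx|lra].
  by rewrite (_ : 2 * 1 - 1 = 1); [exact/e2/e1|lra].
- split; first exact: subset_trans AX.
  move=> b t Bb t01; have Ab := BA _ Bb.
  have [t2|/ltW t2] := leP t (1 / 2).
    by rewrite Hl// f1//; apply: dbl; move: t01 => /andP[-> _].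
  rewrite Hr//; last exact: AX.
  rewrite f1 ?ler01 ?lexx// f2//.
  by apply: dbl'; move: t01 => /andP[_ ->]; rewrite andbT.
Qed.

End Deformation.

(** * Homotopies that transport weights *)

Section Weights.
Variables (R : realType) (disp : Order.disp_t) (P : porderType disp).
Variable S : set P.
Notation T := (realization R S).
Implicit Types (x y : T) (w : P -> R).

Definition admissible w := (forall p, 0 <= w p) /\ simplex S (supp w).

(** [x0] is only returned when [w] is not proportional to a point. *)
Definition normalize x0 w : T :=
  xget x0 [set x : T | forall p, x p = w p / \sum_(q \in [set: P]) w q].

Lemma total_gt0 w : admissible w -> 0 < \sum_(q \in [set: P]) w q.
Proof.
move=> [w0 [[p wp] fw _ _]]; apply: lt_le_trans (fsum_le p fw w0).
by rewrite lt_def w0 andbT.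
Qed.

Lemma normalizeE x0 w p : admissible w ->
  normalize x0 w p = w p / \sum_(q \in [set: P]) w q.
Proof.
move=> aw; have [w0 sw] := aw; have tw := total_gt0 aw.
pose v p := w p / \sum_(q \in [set: P]) w q.
have v0 q : 0 <= v q by rewrite divr_ge0 ?w0 // ltW.
have sv : simplex S [set p | v p != 0].
  rewrite (_ : [set _ | _] = supp w)//; apply/seteqP.
  by split=> q /=; rewrite /supp /v /= mulf_eq0 negb_or invr_eq0 (gt_eqF tw) /= andbT.
have v1 : \sum_(p \in [set: P]) v p = 1.
  by rewrite -mulr_fsuml divff// gt_eqF.
have : [set x : T | forall p, x p = v p] !=set0 by exists (Realization v0 sv v1).
by move=> [y yv]; rewrite /normalize; case: xgetP => [z -> //|/(_ y)/=/(_ yv)].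
Qed.

Lemma admissible_bary x : admissible x.
Proof. by split; [exact: bary_ge0|exact: bary_simplex]. Qed.

Lemma normalize_bary x0 x : normalize x0 x = x.
Proof.
by apply: realization_eq => p; rewrite normalizeE ?bary_sum1 ?divr1//; exact: admissible_bary.
Qed.

Lemma supp_normalize x0 w p : admissible w -> normalize x0 w p != 0 -> supp w p.
Proof. by move=> aw; rewrite normalizeE// mulf_eq0 negb_or => /andP[]. Qed.

Lemma cvg_normalize (U : Type) (F : set_system U) (FF : Filter F) (V : set P)
    (x : U -> T) (w : U -> P -> R) (x0 : T) (w0 : P -> R) : finite_set V ->
  admissible w0 -> supp w0 `<=` V ->
  (\forall z \near F, admissible (w z) /\ supp (w z) `<=` V) ->
  (forall p, w z p @[z --> F] --> w0 p) ->
  normalize (x z) (w z) @[z --> F] --> normalize x0 w0.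
Proof.
move=> fV a0 V0 aV wc; apply: (@cvg_realization _ _ _ _ _ _ _ V
  (fun z => normalize (x z) (w z)) _ fV).
- by apply: filterS aV => z [az zV] p /(supp_normalize az); exact: zV.
- move=> p; rewrite normalizeE//.
  apply: (@cvg_trans _ ((fun z => w z p / \sum_(q \in [set: P]) w z q) @ F)).
    by apply: near_eq_cvg; apply: filterS aV => z [az _]; rewrite normalizeE.
  apply: cvgM; first exact: wc.
  apply: cvgV; first by rewrite gt_eqF// total_gt0.
  apply: (@cvg_fsum _ _ _ _ _ V w w0 fV) => //.
  - by move=> q nVq; apply: suppN => /V0.
  - by apply: filterS aV => z [az zV] q nVq; apply: suppN => /zV.
- by move=> p /(supp_normalize a0); exact: V0.
Qed.

End Weights.

(** The piece [w k x t p] of the weight of the vertex [p] is moved to the vertex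
    [h k p]. *)
Section Transport.
Variables (R : realType) (disp : Order.disp_t) (P : porderType disp).
Variable S : set P.
Notation T := (realization R S).
Variables (K : finType) (h : K -> P -> P) (w : K -> T -> R -> P -> R).
Variables (S' A' : set P).
Notation X := (closed_simplex S' : set T).
Notation A := (closed_simplex A' : set T).

Definition transported x t q :=
  \sum_(k : K) \sum_(p \in [set: P]) (h k p == q)%:R * w k x t p.

(** At such a time the pieces of a vertex add up to its weight and do not move,
    so the transported weight is the point itself. *)
Definition at_rest x t := forall p,
  \sum_(k : K) w k x t p = bary x p /\ forall k, w k x t p != 0 -> h k p = p.

Hypotheses (AS' : A' `<=` S') (SS' : S' `<=` S).
Hypothesis w_ge0 : forall k x t p, X x -> 0 <= t <= 1 -> 0 <= w k x t p.
Hypothesis w_supp : forall k x t p, X x -> 0 <= t <= 1 -> w k x t p != 0 -> x p != 0.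
Hypothesis w_ex : forall x t, X x -> 0 <= t <= 1 -> exists k p, w k x t p != 0.
Hypothesis h_S' : forall k x t p, X x -> 0 <= t <= 1 ->
  w k x t p != 0 -> S' (h k p).
Hypothesis h_chain : forall k l x t p q, X x -> 0 <= t <= 1 ->
  w k x t p != 0 -> w l x t q != 0 -> (h k p >=< h l q)%O.
Hypothesis w_cvg : forall s k x t p, simplex S s -> s `<=` S' ->
  closed_simplex s x -> 0 <= t <= 1 ->
  w k z.1 z.2 p @[z --> prism_nbhs s x t] --> w k x t p.

Lemma transportedP x t q : supp (transported x t) q ->
  exists k p, w k x t p != 0 /\ h k p = q.
Proof.
apply: contraPP => /forallNP nex; apply/negP; rewrite negbK; apply/eqP.
apply: big1 => k _; rewrite fsbig1// => p _.
have [hq|hq] := eqVneq (h k p) q; last by rewrite mul0r.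
by have /forallNP/(_ p)/not_andP[/negP|//] := nex k; rewrite negbK => /eqP ->; rewrite mulr0.
Qed.

Lemma finite_w k x t : X x -> 0 <= t <= 1 -> finite_set (supp (w k x t)).
Proof. by move=> Xx t01; apply: sub_finite_set (finite_supp x) => p /(w_supp Xx t01). Qed.

Lemma transported_gt0 k x t p : X x -> 0 <= t <= 1 -> w k x t p != 0 ->
  0 < transported x t (h k p).
Proof.
move=> Xx t01 wp.
have t0 l r q : 0 <= (h l r == q)%:R * w l x t r by rewrite mulr_ge0// w_ge0.
rewrite /transported (bigD1 k)//= ltr_wpDr//.
  by apply: sumr_ge0 => l _; exact: fsumr_ge0.
have := @fsum_le _ _ (fun r => (h k r == h k p)%:R * w k x t r) p _ (fun r => t0 _ _ _).
rewrite eqxx mul1r => H; apply: lt_le_trans (H _).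
  by rewrite lt_def wp w_ge0.
apply: sub_finite_set (finite_w k Xx t01) => r /=.
by rewrite mulf_eq0 negb_or => /andP[].
Qed.

Lemma admissible_transported x t : X x -> 0 <= t <= 1 ->
  admissible S (transported x t).
Proof.
move=> Xx t01; split.
  by move=> q; apply: sumr_ge0 => k _; apply: fsumr_ge0 => p _; rewrite mulr_ge0// w_ge0.
split.
- have [k [p wp]] := w_ex Xx t01; exists (h k p).
  by rewrite /supp /= gt_eqF// transported_gt0.
- apply: (@sub_finite_set _ _ (\bigcup_(k in [set: K]) h k @` supp x)).
    by move=> q /transportedP[k [p [/(w_supp Xx t01) xp <-]]]; exists k => //; exists p.
  apply: bigcup_finite => [|k _]; first exact: finite_finset.
  exact/finite_image/finite_supp.
- by move=> q /transportedP[k [p [wp <-]]]; exact/SS'/(h_S' Xx t01).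
- move=> q r /transportedP[k [p [wp <-]]] /transportedP[l [p' [wp' <-]]].
  exact: h_chain wp wp'.
Qed.

Lemma transported_at_rest x t : X x -> 0 <= t <= 1 -> at_rest x t ->
  transported x t = bary x.
Proof.
move=> Xx t01 rx; apply/funext => q.
have [<- _] := rx q; apply: eq_bigr => k _.
rewrite (@fsumTE _ _ (supp (w k x t) `|` [set q])).
- rewrite (big_fsetD1 q)/=; last first.
    rewrite in_fset_set ?inE; first by right.
    by rewrite finite_setU; split; [exact: finite_w|exact: finite_set1].
  have -> : (h k q == q)%:R * w k x t q = w k x t q.
    have [->|/(rx q).2 ->] := eqVneq (w k x t q) 0; first by rewrite mulr0.
    by rewrite eqxx mul1r.
  rewrite big1_seq ?addr0// => p /andP[_]; rewrite in_fsetD1 => /andP[pq _].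
  have [->|/(rx p).2 ->] := eqVneq (w k x t p) 0; first by rewrite mulr0.
  by rewrite (negbTE pq) mul0r.
- by rewrite finite_setU; split; [exact: finite_w|exact: finite_set1].
- by move=> p /not_orP[/suppN -> _]; rewrite mulr0.
Qed.

(** The engine of all deformations below.  The total transported mass need not
    be 1, since it is normalized; it suffices that some piece is nonzero, that
    the targets of the nonzero pieces form a chain, and that each piece is
    continuous on every closed simplex. *)
Lemma transport_deforms :
  (forall x, X x -> at_rest x 0) ->
  (forall k x p, X x -> w k x 1 p != 0 -> A' (h k p)) ->
  (forall a t, A a -> 0 <= t <= 1 -> at_rest a t) ->
  deforms R X A.
Proof.
move=> r0 w1 rA.
have l01 : 0 <= (0 : R) <= 1 by rewrite lexx ler01.
have l11 : 0 <= (1 : R) <= 1 by rewrite lexx ler01.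
exists (fun z => normalize z.1 (transported z.1 z.2)); split => /=.
- apply: homotopy_continuous => s x t ss sS' sx t01.
  pose V := \bigcup_(k in [set: K]) h k @` s.
  have fV : finite_set V.
    apply: bigcup_finite => [|k _]; first exact: finite_finset.
    by apply: finite_image; case: ss.
  have VP y u : closed_simplex s y -> 0 <= u <= 1 ->
      admissible S (transported y u) /\ supp (transported y u) `<=` V.
    move=> sy u01; have Xy : X y by move=> p /sy /sS'.
    split; first exact: admissible_transported.
    move=> q /transportedP[k [p [wp <-]]]; exists k => //; exists p => //.
    exact/sy/(w_supp Xy u01 wp).
  have nS : \forall z \near prism_nbhs s x t, closed_simplex s z.1 /\ 0 <= z.2 <= 1.
    exists (closed_simplex s, `[0, 1]%classic) => /=.
      split; first exact: simplex_nbhs_closed.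
      exact: withinT.
    by move=> [y u] [/= sy]; rewrite in_itv.
  have [ax Vx] := VP x t sx t01.
  apply: (@cvg_normalize _ _ _ _ _ (prism_nbhs s x t) _ V fst
    (fun z => transported z.1 z.2) x _ fV) => //.
    by apply: filterS nS => z [sz z01]; exact: VP.
  move=> q; apply: cvg_big => [|k _].
    by move=> z; apply: cvgD; [exact: cvg_fst | exact: cvg_snd].
  have [_ fs _ _] := ss.
  apply: (@cvg_fsum _ _ _ (prism_nbhs s x t) _ s
    (fun z p => (h k p == q)%:R * w k z.1 z.2 p) _ fs).
  - move=> p nsp; have [->|/(w_supp _ t01)] := eqVneq (w k x t p) 0; first by rewrite mulr0.
    by move=> H; exfalso; apply/nsp/sx/H => r /sx /sS'.
  - apply: filterS nS => z [sz z01] p nsp.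
    have [->|/(w_supp _ z01)] := eqVneq (w k z.1 z.2 p) 0; first by rewrite mulr0.
    by move=> H; exfalso; apply/nsp/sz/H => r /sz /sS'.
  - by move=> p; apply: cvgM; [exact: cvg_cst|exact: w_cvg].
- by move=> x Xx; rewrite transported_at_rest ?normalize_bary//; exact: r0.
- move=> x t Xx t01 p /(supp_normalize (admissible_transported Xx t01)).
  by move=> /transportedP[k [q [wq <-]]]; exact: (h_S' Xx t01).
- move=> x Xx p /(supp_normalize (admissible_transported Xx l11)).
  by move=> /transportedP[k [q [wq <-]]]; exact: w1 wq.
- split; first by move=> x Ax p /Ax /AS'.
  move=> a t Aa t01; rewrite transported_at_rest ?normalize_bary//; last exact: rA.
  by move=> p /Aa /AS'.
Qed.

End Transport.

(** * Mass distributed along a chain *)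

Section Overlap.
Variable R : realType.
Implicit Types a b c l r : R.

(** The length of the intersection of the intervals [l, r] and [a, b]. *)
Definition overlap l r a b := Num.max 0 (Num.min r b - Num.max l a).

Lemma overlap_ge0 l r a b : 0 <= overlap l r a b.
Proof. by rewrite /overlap le_max lexx. Qed.

Lemma overlap_gt0 l r a b :
  (0 < overlap l r a b) = [&& l < r, l < b, a < r & a < b].
Proof.
rewrite /overlap lt_max ltxx /= subr_gt0 lt_min !gt_max.
by case: (l < r); case: (l < b); case: (a < r); case: (a < b).
Qed.

Lemma overlap_neq0 l r a b :
  (overlap l r a b != 0) = [&& l < r, l < b, a < r & a < b].
Proof. by rewrite -overlap_gt0 lt_def overlap_ge0 andbT. Qed.

Lemma overlap_split l r a b c : a <= l -> l <= r -> r <= c -> a <= b <= c ->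
  overlap l r a b + overlap l r b c = r - l.
Proof.
move=> al lr rc /andP[ab bc]; rewrite /overlap (max_l al) (min_l rc).
have [rb|br] := leP r b; first have lb := le_trans lr rb.
  rewrite (max_r lb) (max_r (y := r - l)) ?subr_ge0// (max_l (y := r - b)) ?addr0//.
  by rewrite subr_le0.
have [lb|bl] := leP l b.
  rewrite (max_r (y := b - l)) ?subr_ge0// (max_r (y := r - b)) ?subr_ge0; first lra.
  exact: ltW.
rewrite (max_l (y := b - l)) ?subr_le0; last exact: ltW.
by rewrite add0r max_r// subr_ge0.
Qed.

End Overlap.

Section Filters.
Variables (R : realType) (U : Type) (F : set_system U).
Context {FF : Filter F}.
Implicit Types (f g : U -> R) (a b : R).

Lemma cvg_maxr f g a b : f z @[z --> F] --> a -> g z @[z --> F] --> b ->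
  Num.max (f z) (g z) @[z --> F] --> Num.max a b.
Proof.
move=> fa gb.
exact: (cvg_comp _ _ (cvg_pairT FF fa gb) (@max_continuous _ R (a, b))).
Qed.

Lemma cvg_minr f g a b : f z @[z --> F] --> a -> g z @[z --> F] --> b ->
  Num.min (f z) (g z) @[z --> F] --> Num.min a b.
Proof.
move=> fa gb.
exact: (cvg_comp _ _ (cvg_pairT FF fa gb) (@min_continuous _ R (a, b))).
Qed.

Lemma cvg_overlap (l r a b : U -> R) l0 r0 a0 b0 :
  l z @[z --> F] --> l0 -> r z @[z --> F] --> r0 ->
  a z @[z --> F] --> a0 -> b z @[z --> F] --> b0 ->
  overlap (l z) (r z) (a z) (b z) @[z --> F] --> overlap l0 r0 a0 b0.
Proof.
move=> ll rr aa bb; apply: cvg_maxr; first exact: cvg_cst.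
by apply: cvgB; [exact: cvg_minr|exact: cvg_maxr].
Qed.

End Filters.

Section PartialMass.
Variables (R : realType) (disp : Order.disp_t) (P : porderType disp).
Variable S : set P.
Notation T := (realization R S).
Implicit Types (x y : T) (u v : pred P).

Definition mass u x : R := \sum_(p \in [set: P]) (u p)%:R * bary x p.

Lemma mass_ge0 u x : 0 <= mass u x.
Proof. by apply: fsumr_ge0 => p _; rewrite mulr_ge0// bary_ge0. Qed.

Lemma massE u x : mass u x = \sum_(p <- fset_set (supp x)) (u p)%:R * x p.
Proof.
by apply: fsumTE => [|p /suppN ->]; [exact: finite_supp|rewrite mulr0].
Qed.

(** Used to see that the intervals allotted to the vertices of a chain are
    disjoint and ordered as the vertices. *)
Lemma mass_lt u v x p : (forall q, x q != 0 -> v q -> u q) -> u p -> ~~ v p ->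
  mass v x + x p <= mass u x.
Proof.
move=> vu up nvp; have [xp|xp] := eqVneq (x p) 0.
  rewrite xp addr0 !massE big_seq [leRHS]big_seq.
  apply: ler_sum => q; rewrite in_fset_set ?inE; last exact: finite_supp.
  move=> xq; apply: ler_wpM2r; first exact: bary_ge0.
  by rewrite ler_nat; case: (v q) (vu q xq) => // ->.
have pin : p \in fset_set (supp x).
  by rewrite in_fset_set ?inE//; exact: finite_supp.
rewrite !massE (big_fsetD1 p pin)/= [leRHS](big_fsetD1 p pin)/= up (negbTE nvp).
rewrite mul0r add0r mul1r [leLHS]addrC lerD2l big_seq [leRHS]big_seq.
apply: ler_sum => q; rewrite in_fsetD1 in_fset_set; last exact: finite_supp.
move=> /andP[_]; rewrite inE => xq; apply: ler_wpM2r; first exact: bary_ge0.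
by rewrite ler_nat; case: (v q) (vu q xq) => // ->.
Qed.

Lemma mass0 u x : (forall q, x q != 0 -> ~~ u q) -> mass u x = 0.
Proof.
move=> u0; rewrite /mass fsbig1// => q _.
by have [->|/u0/negbTE ->] := eqVneq (x q) 0; rewrite ?mulr0 ?mul0r.
Qed.

Lemma bary_le_mass u x p : u p -> x p <= mass u x.
Proof.
move=> up; have := @mass_lt u pred0 x p (fun _ _ => _) up isT.
by rewrite [mass pred0 x]mass0 ?add0r//; apply.
Qed.

Lemma mass_gt0 u x : 0 < mass u x -> exists p, u p /\ x p != 0.
Proof.
apply: contraPP => /forallNP nu; rewrite mass0 ?ltxx// => q xq.
by apply/negP => uq; exact: (nu q).
Qed.

Lemma massT x : mass predT x = 1.
Proof. by rewrite -(bary_sum1 x); apply: eq_fsbigr => p _; rewrite mul1r. Qed.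

Lemma cvg_bary s x t p : bary z.1 p @[z --> prism_nbhs s x t] --> x p.
Proof. exact: (cvg_comp _ _ cvg_fst (@simplex_nbhs_bary _ _ _ _ s x p)). Qed.

Lemma cvg_mass u s x t : simplex S s -> closed_simplex s x ->
  mass u z.1 @[z --> prism_nbhs s x t] --> mass u x.
Proof.
move=> [_ fs _ _] sx.
apply: (@cvg_fsum _ _ _ _ _ s (fun z p => (u p)%:R * bary z.1 p) _ fs).
- by move=> p nsp; rewrite (@suppN _ _ _ x) ?mulr0// => /sx.
- exists (closed_simplex s, setT) => /=.
    by split; [exact: simplex_nbhs_closed|exact: filterT].
  by move=> [y r] [/= sy _] p nsp; rewrite (@suppN _ _ _ y) ?mulr0// => /sy.
- move=> p; apply: cvgM; first exact: cvg_cst.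
  exact: cvg_bary.
Qed.

Lemma cvg_time s x t : z.2 @[z --> prism_nbhs s x t] --> t.
Proof.
by apply: (cvg_trans (G := unit_nbhs t)); [exact: cvg_snd|exact: cvg_within].
Qed.

End PartialMass.

(** * Cone points and closure operators *)

Section Moves.
Variables (R : realType) (disp : Order.disp_t) (P : porderType disp).
Variable S : set P.
Notation T := (realization R S).
Notation cs A := (closed_simplex A : set T).
Implicit Types (x : T) (u : pred P).

Lemma bary_ex x : exists p, x p != 0.
Proof. by have [[p xp] _ _ _] := bary_simplex x; exists p. Qed.

Lemma bary_comparable x p q : x p != 0 -> x q != 0 -> (p <= q)%O || (q < p)%O.
Proof.
move=> xp xq; have := supp_comparable xp xq.
by move=> /orP[->//|]; rewrite le_eqVlt => /predU1P[->|->]; rewrite ?lexx ?orbT.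
Qed.

(** Every chain extends by the minimum [c], so the segment from a point to the
    vertex [c] stays in the realization. *)
Lemma cone_point_deforms (S' : set P) c : S' c -> S' `<=` S ->
  (forall p, S' p -> (c <= p)%O) -> deforms R (cs S') (cs [set c]).
Proof.
move=> S'c S'S cmin.
apply: (@transport_deforms _ _ _ _ bool (fun k p => if k then c else p)
  (fun k x t p => if k then t * bary x p else (1 - t) * bary x p)) => //.
- by move=> p ->.
- by move=> k x t p _ /andP[t0 t1]; case: k; rewrite mulr_ge0 ?bary_ge0// subr_ge0.
- by move=> k x t p _ _; case: k; rewrite mulf_eq0 negb_or => /andP[].
- move=> x t _ _; have [p xp] := bary_ex x; have [->|t0] := eqVneq t 0.
    by exists false, p; rewrite subr0 mul1r.
  by exists true, p; rewrite mulf_neq0.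
- move=> k x t p Xx _; case: k => // /[!mulf_eq0] /[!negb_or] /andP[_ xp].
  exact: Xx.
- move=> k l x t p q Xx _.
  case: k; case: l; rewrite ?mulf_eq0 ?negb_or => /andP[_ xp] /andP[_ xq].
  + by rewrite comparablexx.
  + by rewrite le_comparable// cmin//; exact: Xx.
  + by rewrite ge_comparable// cmin//; exact: Xx.
  + exact: supp_comparable xp xq.
- move=> s k x t p ss sS' sx t01; case: k; apply: cvgM; try exact: cvg_bary.
    exact: cvg_time.
  by apply: cvgB; [exact: cvg_cst|exact: cvg_time].
- move=> x Xx p; rewrite big_bool/= mul0r subr0 mul1r add0r; split=> //.
  by case=> //=; rewrite eqxx.
- by move=> k x p _; case: k => //=; rewrite subrr mul0r eqxx.
- move=> a t Aa _ p; rewrite big_bool/= -mulrDl addrC subrK mul1r; split=> //.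
  by case=> //=; rewrite mulf_eq0 negb_or => /andP[_ /Aa].
Qed.

(** The vertices of [x] that satisfy [u] cut [0, mass u x] into consecutive
    intervals, in the order of the chain; [lower] and [upper] are the ends of
    the interval of [p], whose length is the weight of [p]. *)
Definition lower (u : pred P) x p : R := mass (fun q => u q && (q < p)%O) x.
Definition upper (u : pred P) x p : R := lower u x p + bary x p.

Lemma lower_ge0 u x p : 0 <= lower u x p. Proof. exact: mass_ge0. Qed.

Lemma lower_le_upper u x p : lower u x p <= upper u x p.
Proof. by rewrite lerDl bary_ge0. Qed.

Lemma lower_lt_upper u x p : (lower u x p < upper u x p) = (x p != 0).
Proof. by rewrite ltrDl lt_def bary_ge0 andbT. Qed.

Lemma upper_le_mass u x p : u p -> upper u x p <= mass u x.
Proof.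
move=> up; apply: mass_lt => //; first by move=> q _ /andP[].
by rewrite ltxx andbF.
Qed.

Lemma upper_le_lower u x p q : u p -> (p < q)%O -> upper u x p <= lower u x q.
Proof.
move=> up pq; apply: mass_lt; rewrite ?up ?ltxx ?andbF//.
by move=> r _ /andP[-> /lt_trans]; apply.
Qed.

Lemma cvg_lower u s x t p : simplex S s -> closed_simplex s x ->
  lower u z.1 p @[z --> prism_nbhs s x t] --> lower u x p.
Proof. exact: cvg_mass. Qed.

Lemma cvg_upper u s x t p : simplex S s -> closed_simplex s x ->
  upper u z.1 p @[z --> prism_nbhs s x t] --> upper u x p.
Proof. by move=> ss sx; apply: cvgD; [exact: cvg_lower|exact: cvg_bary]. Qed.

(** A straight line from [x] to its image under [f] would leave the
    realization, as [p] and [f q] need not be comparable for [q < p].  Instead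
    [0, 1] is cut into intervals as above, and at time [t] exactly the mass
    above the level [1 - t] is moved by [f]: then [p] and [f q] both occur only
    for [p <= q], where [p <= q <= f q]. *)
Lemma closure_deforms (S' : set P) (f : P -> P) : S' `<=` S ->
  (forall p, S' p -> S' (f p)) -> (forall p, S' p -> (p <= f p)%O) ->
  (forall p q, S' p -> S' q -> (p <= q)%O -> (f p <= f q)%O) ->
  (forall p, S' p -> f (f p) = f p) ->
  deforms R (cs S') (cs (S' `&` [set p | f p = p])).
Proof.
move=> S'S fS' idf fmono ff.
pose lo x p := lower predT x p; pose hi x p := upper predT x p.
have hi1 x p : hi x p <= 1 by rewrite -(massT x) upper_le_mass.
apply: (@transport_deforms _ _ _ _ bool (fun k p => if k then f p else p)
  (fun k x t p => if k then overlap (lo x p) (hi x p) (1 - t) 1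
                  else overlap (lo x p) (hi x p) 0 (1 - t))) => //.
- by move=> k x t p _ _; case: k; exact: overlap_ge0.
- move=> k x t p _ _; case: k; rewrite overlap_neq0 => /and4P[+ _ _ _];
    by rewrite lower_lt_upper.
- move=> x t _ /andP[t0 t1]; have [p xp] := bary_ex x.
  have lh : lo x p < hi x p by rewrite lower_lt_upper.
  have lo0 : 0 <= lo x p by exact: lower_ge0.
  have lo1 : lo x p < 1 by exact: lt_le_trans lh (hi1 x p).
  have [lt|tl] := ltP (lo x p) (1 - t).
    exists false, p.
    by rewrite overlap_neq0 lh lt (le_lt_trans lo0 lh) (le_lt_trans lo0 lt).
  by exists true, p; rewrite overlap_neq0 lh lo1 (le_lt_trans tl lh) (le_lt_trans tl lo1).
- move=> k x t p Xx _; case: k; rewrite overlap_neq0 => /and4P[+ _ _ _];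
    by rewrite lower_lt_upper => /Xx//; exact: fS'.
- have cross x t p q : (closed_simplex S' : set T) x ->
      overlap (lo x p) (hi x p) 0 (1 - t) != 0 ->
      overlap (lo x q) (hi x q) (1 - t) 1 != 0 -> (p >=< f q)%O.
    move=> Xx; rewrite !overlap_neq0 => /and4P[+ pt _ _] /and4P[+ _ tq _].
    rewrite !lower_lt_upper => xp xq.
    have /orP[pq|qp] := (bary_comparable xp xq).
      by rewrite le_comparable// (le_trans pq)// idf//; exact: Xx.
    have := upper_le_lower x (u := predT) isT qp.
    by rewrite leNgt (lt_trans pt tq).
  move=> k l x t p q Xx _; case: k; case: l => wp wq.
  + move: wp wq; rewrite !overlap_neq0 => /and4P[+ _ _ _] /and4P[+ _ _ _].
    rewrite !lower_lt_upper => xp xq; have /orP[pq|/ltW qp] := (bary_comparable xp xq).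
      by rewrite le_comparable// fmono//; exact: Xx.
    by rewrite ge_comparable// fmono//; exact: Xx.
  + by rewrite comparable_sym; exact: cross wq wp.
  + exact: cross wp wq.
  + move: wp wq; rewrite !overlap_neq0 => /and4P[+ _ _ _] /and4P[+ _ _ _].
    by rewrite !lower_lt_upper => xp xq; exact: supp_comparable xp xq.
- move=> s k x t p ss sS' sx t01.
  have ct : 1 - z.2 @[z --> prism_nbhs s x t] --> 1 - t.
    by apply: cvgB; [exact: cvg_cst|exact: cvg_time].
  by case: k; apply: cvg_overlap => //; try exact: cvg_lower;
    try exact: cvg_upper; exact: cvg_cst.
- move=> x Xx p; rewrite big_bool/= subr0 addrC overlap_split ?lexx ?ler01//.
  + split; first by rewrite /hi /upper addrC addKr.
    by case=> //=; rewrite overlap_neq0 ltxx !andbF.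
  + exact: lower_ge0.
  + exact: lower_le_upper.
- move=> k x p Xx; case: k; rewrite overlap_neq0; last first.
    by move=> /and4P[_ _ _]; rewrite subrr ltxx.
  move=> /and4P[+ _ _ _]; rewrite lower_lt_upper => /Xx S'p.
  by split; [exact: fS'|exact: ff].
- move=> a t Aa /andP[t0 t1] p; rewrite big_bool/= addrC overlap_split//.
  + split; first by rewrite /hi /upper addrC addKr.
    case=> //=; rewrite overlap_neq0 => /and4P[+ _ _ _].
    by rewrite lower_lt_upper => /Aa[].
  + exact: lower_ge0.
  + exact: lower_le_upper.
  + by rewrite subr_ge0 t1 gerBl.
Qed.

End Moves.

(** * Removing the elements that cross a wall *)

(** [side b q] says that [q] lies on side [b] of a wall.  For a crossing [q],
    [part b q] is the largest element below [q] on side [b], and [wall q] the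
    largest element below [q] on both sides.  In a chain the crossing elements lie above all
    others, and they are pushed down to [part] or [wall] of themselves.

    Which of the two must depend continuously on the point.  An element that
    lies on side [b] only (called pure) is comparable with [part b q] but not
    with [wall q], so [wall] may be used only where no pure element is left.
    Without pure elements there is no reason to prefer one side, so [part] may
    be used only if pure elements have positive mass.  Hence the following
    formulas, in which [cr x] is the mass of the crossing elements. *)
Section Cut.
Variables (R : realType) (disp : Order.disp_t) (P : porderType disp).
Variables (S S' : set P).
Notation T := (realization R S).
Notation cs A := (closed_simplex A : set T).
Implicit Types (x : T) (p q : P) (t : R).
Variables (side : bool -> pred P) (part : bool -> P -> P) (wall : P -> P).

Definition crossing p := ~~ side true p && ~~ side false p.
Let pure b p := side b p && ~~ side (~~ b) p.

Hypothesis S'S : S' `<=` S.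
Hypothesis side_down : forall b p q, S' p -> S' q -> (p <= q)%O -> side b q -> side b p.
Hypothesis partS : forall b q, S' q -> crossing q -> S' (part b q).
Hypothesis wallS : forall q, S' q -> crossing q -> S' (wall q).
Hypothesis partP : forall b p q, S' p -> S' q -> crossing q ->
  (p <= part b q)%O = (p <= q)%O && side b p.
Hypothesis wallP : forall p q, S' p -> S' q -> crossing q ->
  (p <= wall q)%O = [&& (p <= q)%O, side true p & side false p].

Let cr x : R := mass crossing x.

(** Of the crossing mass, read as the interval [0, cr x], the segment up to
    [room b x] goes to [wall] and the rest to [part b].  As pure elements of
    opposite sides exclude each other, at most one of the two rooms is smaller
    than [cr x]; when a room is positive, pure elements of that side have a
    total mass less than [cr x]. *)
Let room b x := Num.max 0 (cr x - mass (pure b) x).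

(** During the second half of the time this level sweeps the crossing mass;
    the mass below it has been pushed down. *)
Let front x t := cr x * Num.max 0 (2 * t - 1).

(** During the first half of the time every pure vertex loses up to this much.
    At the end, if some crossing mass is to go to [wall], then each pure weight
    is less than [cr x] and has vanished. *)
Let toll x t := cr x * Num.min 1 (2 * t).
Let meet x := Num.min (room true x) (room false x).

Let target (k : option (option bool)) p :=
  match k with None => p | Some None => wall p | Some (Some b) => part b p end.

Let weight (k : option (option bool)) x t p :=
  let piece a b := overlap (lower crossing x p) (upper crossing x p) a b in
  match k with
  | None => if crossing p then piece (front x t) (cr x)
            else if side true p && side false p then bary x p
            else Num.max 0 (bary x p - toll x t)
  | Some None =>
      if crossing p then piece 0 (Num.min (meet x) (front x t)) else 0
  | Some (Some b) =>
      if crossing p then piece (Num.min (room b x) (front x t)) (front x t) else 0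
  end.

Let cr_ge0 x : 0 <= cr x. Proof. exact: mass_ge0. Qed.

Let front_le x t : 0 <= t <= 1 -> front x t <= cr x.
Proof. by move=> /andP[_ t1]; rewrite ler_piMr// ge_max ler01/=; lra. Qed.

Let toll_ge0 x t : 0 <= t <= 1 -> 0 <= toll x t.
Proof. by move=> /andP[t0 _]; rewrite mulr_ge0// le_min ler01 mulr_ge0. Qed.

Let weight_cr k x t p : crossing p -> weight k x t p != 0 ->
  [/\ x p != 0,
      k = None -> front x t < upper crossing x p,
      k != None -> lower crossing x p < front x t,
      k = Some None -> lower crossing x p < meet x &
      forall b, k = Some (Some b) ->
        room b x < front x t /\ room b x < upper crossing x p].
Proof.
move=> cp; case: k => [[b|]|] /=; rewrite cp overlap_neq0 => /and4P[].
- rewrite lower_lt_upper => xp lf ru rf; split=> // _ [<-].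
  move: ru rf; rewrite !gt_min ltxx orbF => ru rf; split=> //.
  by case/orP: ru => // /(lt_trans rf).
- by rewrite lower_lt_upper lt_min => xp /andP[lm lf] _ _; split.
- by rewrite lower_lt_upper => xp _ fu _; split.
Qed.

Let weight_ncr k x t p : 0 <= t <= 1 -> ~~ crossing p -> weight k x t p != 0 ->
  [/\ x p != 0, k = None & forall b, pure b p -> toll x t < x p].
Proof.
move=> t01 /negbTE cp; case: k => [[b|]|] /=; rewrite cp ?eqxx//.
case: ifPn => [/andP[st sf] xp|ns].
  by split=> // -[]; rewrite /pure st sf.
rewrite /Num.max; case: ifPn => [|_]; last by rewrite eqxx.
rewrite subr_gt0 => tx _; split=> //.
by rewrite gt_eqF// (le_lt_trans (toll_ge0 x t01)).
Qed.

Let weight_supp k x t p : 0 <= t <= 1 -> weight k x t p != 0 -> x p != 0.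
Proof.
by move=> t01; have [cp|cp] := boolP (crossing p);
  [case/(weight_cr cp)|case/(weight_ncr t01 cp)].
Qed.

Let part_le b q : S' q -> crossing q -> (part b q <= q)%O /\ side b (part b q).
Proof.
by move=> Sq cq; have := partP b (partS b Sq cq) Sq cq; rewrite lexx => /esym/andP[].
Qed.

Let wall_le q : S' q -> crossing q -> (wall q <= q)%O /\ forall b, side b (wall q).
Proof.
move=> Sq cq; have := wallP (wallS Sq cq) Sq cq.
by rewrite lexx => /esym/and3P[wq wt wf]; split=> // -[].
Qed.

(** Elements on one side form a lower set, so two comparable elements cannot be
    pure for opposite sides. *)
Let pure_excl x b r r' : cs S' x -> x r != 0 -> x r' != 0 ->
  pure b r -> pure (~~ b) r' -> False.
Proof.
move=> Xx xr xr' /andP[br nbr] /andP[nbr']; rewrite negbK => br'.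
have [Sr Sr'] := (Xx _ xr, Xx _ xr').
case/orP: (bary_comparable xr xr') => [|/ltW] le.
  by move: nbr; rewrite (side_down Sr Sr' le nbr').
by move: br'; rewrite (side_down Sr' Sr le br).
Qed.

(** A piece is moved to [part b] only beyond [room b x], hence only in the
    presence of a pure element of side [b]. *)
Let room_lt b x : room b x < cr x -> exists r, pure b r /\ x r != 0.
Proof.
by rewrite gt_max => /andP[c0]; rewrite gtrBl => /mass_gt0.
Qed.

(** The case analysis that justifies the choice of room and toll: [target k p]
    could fail to be comparable with [target l q] when [p] is pure and [q] goes
    to [wall], or when [p] and [q] go to opposite sides, and the weights exclude
    both. *)
Let target_comparable_le k l x t p q : cs S' x -> 0 <= t <= 1 -> (p <= q)%O ->
  weight k x t p != 0 -> weight l x t q != 0 -> (target k p >=< target l q)%O.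
Proof.
move=> Xx t01 pq wp wq.
have xp := weight_supp t01 wp; have xq := weight_supp t01 wq.
have [Sp Sq] := (Xx _ xp, Xx _ xq).
have [cq|ncq] := boolP (crossing q); last first.
  have ncp : ~~ crossing p.
    apply: contra ncq => /andP[pt pf]; rewrite /crossing.
    by rewrite !(contra (side_down Sp Sq pq)).
  have [_ -> _] := weight_ncr t01 ncp wp; have [_ -> _] := weight_ncr t01 ncq wq.
  by rewrite le_comparable.
have [_ _ lf lm rf] := weight_cr cq wq.
have fc := front_le x t01.
have [cp|ncp] := boolP (crossing p); last first.
  have [_ -> tp] := weight_ncr t01 ncp wp; apply: le_comparable => /=.
  case: l wq lf lm rf => [[b|]|] _ //= lf lm rf.
  - rewrite partP// pq/=; have [rb _] := rf b erefl.
    have [r [br xr]] := room_lt (lt_le_trans rb fc).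
    apply/negPn/negP => nb; apply: (pure_excl Xx xr xp br).
    rewrite /pure negbK nb andbT; move: ncp nb; rewrite /crossing.
    by case: b {lf lm rf rb br}; case: (side true p); case: (side false p).
  - rewrite wallP// pq/=.
    have f0 : 0 < front x t by apply: le_lt_trans (lf isT); exact: lower_ge0.
    (* some mass is on its way to the wall, so the toll has been paid in full *)
    have tE : toll x t = cr x.
      move: f0; rewrite /front /toll => /lt0r_neq0; rewrite mulf_eq0 negb_or => /andP[_].
      rewrite /Num.max; case: ifPn => [t2 _|_]; last by rewrite eqxx.
      by rewrite min_l ?mulr1//; lra.
    have m0 : 0 < meet x by apply: le_lt_trans (lm erefl); exact: lower_ge0.
    have np b : ~~ pure b p.
      apply/negP => bp; have := tp b bp; rewrite tE => cxp.
      have rb0 : 0 < room b x by case: b {bp} m0; rewrite lt_min => /andP[].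
      have := bary_le_mass x bp => /(lt_le_trans cxp).
      by move: rb0; rewrite lt_max ltxx/= subr_gt0 => /lt_trans h /h; rewrite ltxx.
    move: ncp (np true) (np false); rewrite /crossing /pure.
    by case: (side true p); case: (side false p).
have [_ fu _ _ ru] := weight_cr cp wp.
have [pEq|pltq] : p = q \/ (p < q)%O by move: pq; rewrite le_eqVlt => /predU1P.
  subst q; have [wl ws] := wall_le Sp cp.
  have pl b := (part_le b Sp cp).1.
  have wpl b : (wall p <= part b p)%O by rewrite partP// ?wl ?ws//; exact: wallS.
  case: k wp fu ru => [[b|]|] _ fu ru; case: l wq lf lm rf => [[c|]|] _ lf lm rf /=;
    rewrite ?comparablexx//; try (by rewrite le_comparable); try by rewrite ge_comparable.
  have [->|bc] := eqVneq b c; first by rewrite comparablexx.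
  have [r [br xr]] := room_lt (lt_le_trans (ru b erefl).1 fc).
  have [r' [br' xr']] := room_lt (lt_le_trans (rf c erefl).1 fc).
  have cE : c = ~~ b by clear -bc; case: b c bc => -[].
  by exfalso; rewrite cE in br'; exact: pure_excl Xx xr xr' br br'.
have ul := upper_le_lower x cp pltq.
have [wl ws] := wall_le Sp cp.
have pl b := part_le b Sp cp.
have wSp := wallS Sp cp.
case: k wp fu ru => [[b|]|] _ fu ru; case: l wq lf lm rf => [[c|]|] _ lf lm rf /=.
- have [<-|bc] := eqVneq b c.
    by rewrite le_comparable// partP ?(le_trans (pl b).1 pq) ?(pl b).2//; exact: partS.
  have [r [br xr]] := room_lt (lt_le_trans (ru b erefl).1 fc).
  have [r' [br' xr']] := room_lt (lt_le_trans (rf c erefl).1 fc).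
  have cE : c = ~~ b by clear -bc; case: b c bc => -[].
  by exfalso; rewrite cE in br'; exact: pure_excl Xx xr xr' br br'.
- have := lt_le_trans (ru b erefl).2 ul => /lt_trans /(_ (lm erefl)).
  by rewrite lt_min; case: b {ru fu}; rewrite ltxx ?andbF.
- by rewrite le_comparable// (le_trans (pl b).1).
- by rewrite le_comparable// partP ?(le_trans wl pq) ?ws.
- by rewrite le_comparable// wallP ?(le_trans wl pq) ?ws.
- by rewrite le_comparable// (le_trans wl).
- by have := lt_le_trans (fu erefl) ul; rewrite ltNge (ltW (lf isT)).
- by have := lt_le_trans (fu erefl) ul; rewrite ltNge (ltW (lf isT)).
- by rewrite le_comparable.
Qed.

Let weight_ex x t : 0 <= t <= 1 -> exists k p, weight k x t p != 0.
Proof.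
move=> t01; have [cr0|ncr0] := pselect (exists p, crossing p /\ x p != 0).
  have [p [cp xp]] := cr0.
  have lu : lower crossing x p < upper crossing x p by rewrite lower_lt_upper.
  have uc : upper crossing x p <= cr x by exact: upper_le_mass.
  have l0 := lower_ge0 crossing x p.
  have [fu|uf] := ltP (front x t) (upper crossing x p).
    exists None, p; rewrite /= cp overlap_neq0 lu fu (lt_le_trans lu uc)/=.
    exact: lt_le_trans fu uc.
  have lf := lt_le_trans lu uf.
  have [lm|ml] := ltP (lower crossing x p) (meet x).
    have lmf : lower crossing x p < Num.min (meet x) (front x t) by rewrite lt_min lm lf.
    exists (Some None), p; rewrite /= cp overlap_neq0 lu lmf.
    by rewrite (le_lt_trans l0 lu) (le_lt_trans l0 lmf).
  have [b rl] : exists b, room b x <= lower crossing x p.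
    by move: ml; rewrite ge_min => /orP[]; [exists true|exists false].
  exists (Some (Some b)), p; rewrite /= cp overlap_neq0 lu lf !gt_min.
  by rewrite (le_lt_trans rl lu) (le_lt_trans rl lf).
have c0 : cr x = 0.
  by apply: mass0 => q xq; apply/negP => cq; apply: ncr0; exists q.
have [p xp] := bary_ex x; exists None, p => /=.
have [cp|_] := boolP (crossing p); first by exfalso; apply: ncr0; exists p.
case: ifPn => // _; rewrite /toll c0 mul0r subr0 max_r ?bary_ge0//.
Qed.

Let weight_at_rest x t : cs S' x -> 0 <= t <= 1 ->
  (t = 0 \/ cr x = 0) -> at_rest target weight x t.
Proof.
move=> Xx t01 t0c0.
have f0 : front x t = 0.
  by case: t0c0 => [->|c0]; rewrite /front ?c0 ?mul0r// mulr0 sub0r max_l ?mulr0//; lra.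
have k0 : toll x t = 0.
  by case: t0c0 => [->|c0]; rewrite /toll ?c0 ?mul0r// mulr0 min_r ?mulr0//; lra.
have w0 k p : k != None -> weight k x t p = 0.
  move=> kN; apply/eqP/negPn/negP => wp; have [cp|cp] := boolP (crossing p).
    have [_ _ /(_ kN)] := weight_cr cp wp.
    by rewrite f0 ltNge lower_ge0.
  by have [_ kE] := weight_ncr t01 cp wp; rewrite kE in kN.
have wN p : weight None x t p = x p.
  rewrite /= f0 k0; case: ifPn => [cp|_]; last first.
    by case: ifPn => // _; rewrite subr0 max_r ?bary_ge0.
  set l := lower _ _ _; set r := upper _ _ _.
  have oz : overlap l r 0 0 = 0.
    by apply/eqP; have := overlap_neq0 l r 0 0; rewrite ltxx !andbF => /negbFE.
  have c0 : (0 : R) <= 0 <= cr x by rewrite lexx cr_ge0.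
  have := overlap_split (lower_ge0 crossing x p) (lower_le_upper crossing x p)
    (upper_le_mass x cp) c0.
  by rewrite -/l -/r oz add0r => ->; rewrite /r /upper -/l addrC addKr.
move=> p; split; first by rewrite (bigD1 None)// wN big1 => [|k /w0 ->//]; exact: addr0.
by move=> [k|]//; rewrite w0 ?eqxx.
Qed.

(** The deformation is stationary on points without crossing elements, where
    [cr x = 0] makes both the toll and the front vanish. *)
Lemma cut_deforms : deforms R (cs S') (cs (S' `&` [set p | ~~ crossing p])).
Proof.
have l11 : 0 <= (1 : R) <= 1 by rewrite lexx ler01.
apply: (@transport_deforms _ _ _ _ _ target weight) => //.
- move=> k x t p _ t01; case: k => [[b|]|] /=; case: ifP => // _; rewrite ?overlap_ge0//.
  by case: ifP => _; rewrite ?bary_ge0// le_max lexx.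
- by move=> k x t p _; exact: weight_supp.
- by move=> x t _; exact: weight_ex.
- move=> k x t p Xx t01 wp; have Sp := Xx _ (weight_supp t01 wp).
  have [cp|cp] := boolP (crossing p); last by have [_ -> _] := weight_ncr t01 cp wp.
  by case: k wp => [[b|]|] _ //=; [exact: partS|exact: wallS].
- move=> k l x t p q Xx t01 wp wq.
  have /orP[pq|/ltW qp] := bary_comparable (weight_supp t01 wp) (weight_supp t01 wq).
    exact: target_comparable_le Xx t01 pq wp wq.
  by rewrite comparable_sym; exact: target_comparable_le Xx t01 qp wq wp.
- move=> s k x t p ss sS' sx t01.
  have ccr : cr z.1 @[z --> prism_nbhs s x t] --> cr x by exact: cvg_mass.
  have croom b : room b z.1 @[z --> prism_nbhs s x t] --> room b x.
    apply: cvg_maxr; first exact: cvg_cst.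
    by apply: cvgB => //; exact: cvg_mass.
  have c2 : 2 * z.2 @[z --> prism_nbhs s x t] --> 2 * t.
    by apply: cvgM; [exact: cvg_cst|exact: cvg_time].
  have cfront : front z.1 z.2 @[z --> prism_nbhs s x t] --> front x t.
    apply: cvgM => //; apply: cvg_maxr; first exact: cvg_cst.
    by apply: cvgB => //; exact: cvg_cst.
  have ctoll : toll z.1 z.2 @[z --> prism_nbhs s x t] --> toll x t.
    by apply: cvgM => //; apply: cvg_minr; first exact: cvg_cst.
  have cl : lower crossing z.1 p @[z --> prism_nbhs s x t] --> lower crossing x p
    by exact: cvg_lower.
  have cu : upper crossing z.1 p @[z --> prism_nbhs s x t] --> upper crossing x p
    by exact: cvg_upper.
  case: k => [[b|]|] /=; case: (boolP (crossing p)) => cp; try exact: cvg_cst.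
  + by apply: cvg_overlap => //; exact: cvg_minr.
  + apply: cvg_overlap => //; first exact: cvg_cst.
    by apply: cvg_minr => //; exact: cvg_minr.
  + exact: cvg_overlap.
  + case: ifP => _; first exact: cvg_bary.
    apply: cvg_maxr; first exact: cvg_cst.
    by apply: cvgB => //; exact: cvg_bary.
- by move=> x Xx; apply: weight_at_rest => //; [rewrite lexx ler01|left].
- move=> k x p Xx wp; have Sp := Xx _ (weight_supp l11 wp).
  have [cp|cp] := boolP (crossing p); last by have [_ -> _] := weight_ncr l11 cp wp.
  have nc q b : side b q -> ~~ crossing q.
    by rewrite /crossing; case: b => ->; rewrite ?andbF.
  case: k wp => [[b|]|] wp /=.
  + by split; [exact: partS|apply: (nc _ b); exact: (part_le b Sp cp).2].
  + by split; [exact: wallS|apply: (nc _ true); exact: (wall_le Sp cp).2].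
  + exfalso; have [_ /(_ erefl) + _ _ _] := weight_cr cp wp.
    rewrite ltNge (le_trans (upper_le_mass x cp))//.
    by rewrite /front max_r ?mulr1 -/(cr x); [rewrite (_ : 2 - 1 = 1) ?mulr1//; lra|lra].
- move=> a t Aa t01; apply: weight_at_rest => //; first by move=> p /Aa[].
  by right; apply: mass0 => q /Aa[].
Qed.

End Cut.

(** * Rational cones and half-spaces *)

Section ConeGeometry.
Variables (R : realType) (d : nat).
Notation V := 'rV[R]_d.
Implicit Types (A : set V) (C D : cone R d) (x y : V) (j : 'I_d).

Definition hull (I : finType) (x : I -> V) : set V :=
  [set y | exists2 a : I -> R, forall i, 0 <= a i & y = \sum_i a i *: x i].

Lemma conic_hull_enum (I : finType) (x : I -> V) :
  hull x = conic_hull (fun k : 'I_#|I| => x (enum_val k)).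
Proof.
apply/seteqP; split=> y [a a0 ->].
  exists (fun k => a (enum_val k)) => //.
  by rewrite (reindex (@enum_val I predT))//=; exact/onW_bij/enum_val_bij.
exists (fun i => a (enum_rank i)) => //.
rewrite (reindex (@enum_val I predT))/=; last exact/onW_bij/enum_val_bij.
by apply: eq_bigr => k _; rewrite enum_valK.
Qed.

Lemma is_cone_hull (I : finType) (x : I -> V) A :
  (forall i, integral_points (x i)) -> A = hull x -> pointed A -> is_cone A.
Proof.
move=> xZ Ax pA; split=> //; exists #|I|, (fun k => x (enum_val k)).
by split=> //; rewrite Ax conic_hull_enum.
Qed.

Lemma hullD (I : finType) (x : I -> V) u v : hull x u -> hull x v -> hull x (u + v).
Proof.
move=> [a a0 ->] [b b0 ->]; exists (fun i => a i + b i); first by move=> i; rewrite addr_ge0.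
by rewrite -big_split/=; apply: eq_bigr => i _; rewrite scalerDl.
Qed.

Lemma hullZ (I : finType) (x : I -> V) c u : 0 <= c -> hull x u -> hull x (c *: u).
Proof.
move=> c0 [a a0 ->]; exists (fun i => c * a i); first by move=> i; rewrite mulr_ge0.
by rewrite scaler_sumr; apply: eq_bigr => i _; rewrite scalerA.
Qed.

Lemma hull0 (I : finType) (x : I -> V) : hull x 0.
Proof. by exists (fun=> 0) => //; rewrite big1// => i _; rewrite scale0r. Qed.

Lemma hull_gen (I : finType) (x : I -> V) i : hull x (x i).
Proof.
exists (fun k => (k == i)%:R) => //; rewrite (bigD1 i)//= eqxx scale1r big1 ?addr0//.
by move=> k /negbTE ->; rewrite scale0r.
Qed.

Lemma hull_sum (I : finType) (x : I -> V) (J : finType) (p : pred J) (u : J -> V) :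
  (forall k, p k -> hull x (u k)) -> hull x (\sum_(k | p k) u k).
Proof.
move=> xu; elim/big_ind: _ => //; [exact: hull0|exact: hullD].
Qed.

Lemma cone_hull C : exists n (x : 'I_n -> V),
  (forall i, integral_points (x i)) /\ cone_set C = hull x.
Proof. by have [[n [x [xZ Cx]]] _] := coneP C; exists n, x. Qed.

Lemma coneD C x y : cone_set C x -> cone_set C y -> cone_set C (x + y).
Proof. by have [n [g [_ ->]]] := cone_hull C; exact: hullD. Qed.

Lemma coneZ C c x : 0 <= c -> cone_set C x -> cone_set C (c *: x).
Proof. by have [n [g [_ ->]]] := cone_hull C; exact: hullZ. Qed.

Lemma cone0 C : cone_set C 0.
Proof. by have [n [g [_ ->]]] := cone_hull C; exact: hull0. Qed.

Lemma cone_pointed C : pointed C. Proof. by case: (coneP C). Qed.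

Lemma cone_eq C D : cone_set C = cone_set D -> C = D.
Proof.
case: C D => A Ac [B Bc] /= AB; subst B; congr Cone; exact: Prop_irrelevance.
Qed.

(** The zero cone serves as a default value, so that constructions that yield
    cones only under a hypothesis are total functions. *)
Definition to_cone A : cone R d :=
  match pselect (is_cone A) with left Ac => Cone Ac | right _ => zero_cone R d end.

Lemma to_coneE A : is_cone A -> cone_set (to_cone A) = A.
Proof. by move=> Ac; rewrite /to_cone; case: pselect. Qed.

Definition sg (b : bool) : R := if b then 1 else -1.

Definition halfcone j b A : set V := A `&` [set x | 0 <= sg b * x ord0 j].

(** One step of Fourier-Motzkin elimination (the double description method):
    the half of a cone where the linear form [l] is nonnegative is generated by
    the generators with [0 <= l] and, for each pair with [0 < l x] and
    [l y < 0], by the combination [l x *: y - l y *: x] on which [l] vanishes. *)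
Lemma halfcone_is_cone j b C : is_cone (halfcone j b C).
Proof.
have [n [x [xZ Cx]]] := cone_hull C.
pose l y := sg b * y ord0 j.
(* pairs (k, k) with 0 <= l give back the generators, the other pairs that are
   not of opposite signs give a redundant generator *)
pose g (k : 'I_n * 'I_n) : V :=
  if (0 < l (x k.1)) && (l (x k.2) < 0)
  then l (x k.1) *: x k.2 - l (x k.2) *: x k.1
  else if 0 <= l (x k.1) then x k.1 else 0.
have lZ i : l (x i) \is a Num.int.
  by rewrite /l /sg; case: b {l g}; rewrite ?mul1r ?mulN1r ?rpredN; exact: xZ.
have lD : {morph l : y z / y + z} by move=> y z; rewrite /l mxE mulrDr.
have lS c y : l (c *: y) = c * l y by rewrite /l mxE mulrCA.
have l0 : l 0 = 0 by rewrite /l mxE mulr0.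
have lsum (p : pred 'I_n) a : l (\sum_(i | p i) a i *: x i) = \sum_(i | p i) a i * l (x i).
  by rewrite (big_morph l lD l0); apply: eq_bigr => i _; rewrite lS.
apply: (@is_cone_hull _ g).
- move=> [k1 k2]; rewrite /g /=; case: ifP => _; last first.
    by case: ifP => _ // i; rewrite mxE rpred0.
  by move=> i; rewrite !mxE rpredB// rpredM// xZ.
- pose pos i := 0 < l (x i); pose neg i := l (x i) < 0; pose zer i := l (x i) == 0.
  have gpn k i : pos k -> neg i -> g (k, i) = l (x k) *: x i - l (x i) *: x k.
    by rewrite /pos /neg /g /= => -> ->.
  have gx i : ~~ neg i -> hull g (x i).
    rewrite /neg -leNgt => li; rewrite (_ : x i = g (i, i)); first exact: hull_gen.
    by rewrite /g /= li [l (x i) < 0]ltNge li andbF.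
  apply/seteqP; split=> y.
    rewrite /halfcone Cx => -[[a a0 ->]]; rewrite /mkset -/(l _) (lsum predT) => ly.
    have split3 (W : zmodType) (f : 'I_n -> W) : \sum_i f i =
        \sum_(i | zer i) f i + \sum_(i | pos i) f i + \sum_(i | neg i) f i.
      rewrite (bigID zer)/= -addrA; congr (_ + _).
      rewrite (bigID pos)/=; congr (_ + _); apply: eq_bigl => i;
        by rewrite /zer /pos /neg; case: (ltgtP (l (x i)) 0).
    rewrite split3; move: ly; rewrite split3 [X in X + _ + _]big1 ?add0r; last first.
      by move=> i /eqP ->; rewrite mulr0.
    set X := \sum_(i | pos i) a i *: x i; set Y := \sum_(i | neg i) a i *: x i.
    set p := \sum_(i | pos i) _; set q := \sum_(i | neg i) _ => pq0.
    have hX : hull g X.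
      apply: hull_sum => i /ltW li; apply: hullZ => //; apply: gx.
      by rewrite /neg -leNgt.
    have hZ : hull g (\sum_(i | zer i) a i *: x i).
      apply: hull_sum => i /eqP li; apply: hullZ => //; apply: gx.
      by rewrite /neg li ltxx.
    have aneg i : neg i -> 0 <= - (a i * l (x i)).
      by move=> /ltW li; rewrite -mulrN mulr_ge0 ?oppr_ge0.
    have q0 : q <= 0 by rewrite -oppr_ge0 -sumrN; apply: sumr_ge0.
    have p0 : 0 <= p by apply: sumr_ge0 => i /ltW li; exact: mulr_ge0.
    rewrite -addrA; apply: hullD => //.
    have [pE|pN] := eqVneq p 0.
      have qE : q = 0 by apply/eqP; rewrite eq_le q0; move: pq0; rewrite pE add0r.
      suff -> : Y = 0 by rewrite addr0.
      apply: big1 => i ni; suff -> : a i = 0 by rewrite scale0r.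
      have : \sum_(i | neg i) - (a i * l (x i)) == 0 by rewrite sumrN -/q qE oppr0.
      rewrite psumr_eq0// => /allP/(_ i); rewrite mem_index_enum => /(_ isT)/implyP/(_ ni).
      by rewrite oppr_eq0 mulf_eq0 => /orP[/eqP//|]; rewrite lt_eqF.
    have pp : 0 < p by rewrite lt_def pN.
    pose W := \sum_(k | pos k) \sum_(i | neg i) (a k * a i) *: g (k, i).
    have hW : hull g W.
      apply: hull_sum => k _; apply: hull_sum => i _; apply: hullZ; first exact: mulr_ge0.
      exact: hull_gen.
    have WE : W = p *: Y - q *: X.
      transitivity (\sum_(k | pos k) ((a k * l (x k)) *: Y - q *: (a k *: x k))); last first.
        by rewrite big_split/= sumrN -scaler_suml -scaler_sumr.
      apply: eq_bigr => k pk.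
      rewrite scaler_sumr scaler_suml -sumrB; apply: eq_bigr => i ni.
      rewrite gpn// scalerBr !scalerA; congr (_ *: _ - _ *: _); ring.
    (* X and Y are the parts of y with l > 0 and l < 0; p and q are their values *)
    have -> : X + Y = (p + q) / p *: X + p^-1 *: W.
      rewrite WE scalerBr !scalerA mulVf// scale1r mulrDl divff// scalerDl scale1r.
      by rewrite [p^-1 * q]mulrC addrACA subrr addr0.
    by apply: hullD; apply: hullZ => //; rewrite ?invr_ge0// divr_ge0.
  move=> [a a0 ->]; split.
    rewrite Cx; apply: hull_sum => -[k i] _; apply: hullZ => //; rewrite /g /=.
    case: ifP => [/andP[lk li]|_]; last by case: ifP => _; [exact: hull_gen|exact: hull0].
    rewrite -scaleNr; apply: hullD; apply: hullZ; try exact: hull_gen; first exact: ltW.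
    by rewrite oppr_ge0 ltW.
  rewrite /mkset -/(l _) (big_morph l lD l0); apply: sumr_ge0 => -[k i] _.
  rewrite lS mulr_ge0// /g /=; case: ifP => [/andP[lk li]|_].
    by rewrite lD -scaleNr !lS mulNr mulrC subrr.
  by case: ifP => // _; rewrite l0.
- by move=> y [Cy _] [Cy' _]; exact: (cone_pointed Cy Cy').
Qed.

(** The segment between points strictly on both sides meets the hyperplane,
    and not at the origin because the cone is pointed. *)
Lemma cross_wall j C : ~ (forall x, cone_set C x -> 0 <= x ord0 j) ->
  ~ (forall x, cone_set C x -> x ord0 j <= 0) ->
  exists z, [/\ cone_set C z, z ord0 j = 0 & z <> 0].
Proof.
move=> /existsNP[x /not_implyP[Cx /negP]]; rewrite -ltNge => xj.
move=> /existsNP[y /not_implyP[Cy /negP]]; rewrite -ltNge => yj.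
have Cu : cone_set C (y ord0 j *: x) by apply: coneZ => //; exact: ltW.
have Cv : cone_set C (- x ord0 j *: y) by apply: coneZ => //; rewrite oppr_ge0 ltW.
exists (y ord0 j *: x + - x ord0 j *: y); split; first exact: coneD.
  by rewrite !mxE mulNr mulrC subrr.
move=> /eqP; rewrite addr_eq0 => /eqP uv.
have u0 : y ord0 j *: x = 0.
  by apply: (cone_pointed Cu); rewrite uv opprK.
have := congr1 (fun w : V => w ord0 j) u0; rewrite !mxE => /eqP.
by rewrite mulf_eq0 gt_eqF// lt_eqF.
Qed.

End ConeGeometry.

(** * Orthant faces and sign vectors *)

Section Orthants.
Variables (R : realType) (d : nat).
Notation V := 'rV[R]_d.
Notation signs := {ffun 'I_d -> option bool}.
Implicit Types (A : set V) (C D : cone R d) (x y : V) (j : 'I_d) (s : signs).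

(** The face of a coordinate orthant with sign vector [s]; [None] stands for
    the sign 0. *)
Definition orthant_set s : set V :=
  [set x : V | forall j,
     if s j is Some b then is_true (0 <= sg R b * x ord0 j) else x ord0 j = 0].

Definition sgo (o : option bool) : R := if o is Some b then sg R b else 0.

Lemma sg_neq0 b : sg R b != 0.
Proof. by case: b; rewrite /sg ?oppr_eq0 oner_eq0. Qed.

Lemma sgK b : sg R b * sg R b = 1.
Proof. by case: b; rewrite /sg ?mulrNN mulr1. Qed.

Lemma orthant_is_cone s : is_cone (orthant_set s).
Proof.
apply: (@is_cone_hull _ _ _ (fun j => sgo (s j) *: delta_mx ord0 j)).
- move=> j i; rewrite !mxE eqxx/= rpredM//; last by rewrite rpred_nat.
  by case: (s j) => [[]|]; rewrite /sgo /sg ?rpredN ?rpred1 ?rpred0.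
- apply/seteqP; split=> x.
    move=> xs; exists (fun j => sgo (s j) * x ord0 j).
      by move=> j; have := xs j; case: (s j) => [b|]//= _; rewrite mul0r.
    apply/rowP => i; rewrite summxE (bigD1 i)//= big1 ?addr0 => [|j ji]; rewrite !mxE eqxx.
      have := xs i; rewrite eqxx mulr1; case: (s i) => [b _|->]; rewrite /sgo ?mulr0//.
      by rewrite mulrAC sgK mul1r.
    by rewrite eq_sym (negbTE ji) /= !mulr0.
  move=> [a a0 ->] i; rewrite summxE (bigD1 i)//= big1 ?addr0 => [|j ji]; last first.
    by rewrite !mxE eqxx eq_sym (negbTE ji)/= !mulr0.
  rewrite !mxE !eqxx mulr1; case: (s i) => [b|] /=; last by rewrite mulr0.
  by rewrite mulrCA sgK mulr1.
- move=> x sx snx; apply/rowP => j; rewrite mxE; apply/eqP.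
  have := sx j; have := snx j; rewrite mxE; case: (s j) => [b|_ ->//].
  rewrite mulrN oppr_ge0 => le0 ge0.
  have : sg R b * x ord0 j == 0 by rewrite eq_le le0 ge0.
  by rewrite mulf_eq0 (negbTE (sg_neq0 b)).
Qed.

Definition orthant s : cone R d := Cone (orthant_is_cone s).

Definition side j b C : bool := `[< forall x, cone_set C x -> 0 <= sg R b * x ord0 j >].

Lemma sideP j b C :
  reflect (forall x, cone_set C x -> 0 <= sg R b * x ord0 j) (side j b C).
Proof. exact: asboolP. Qed.

Lemma side_orthant j b s : side j b (orthant s) = (s j != Some (~~ b)).
Proof.
apply/sideP/idP => [sb|sj x /(_ j)].
  apply/eqP => sj; have : orthant_set s (sg R (~~ b) *: delta_mx ord0 j).
    move=> i; rewrite !mxE eqxx /=; have [->|ij] := eqVneq i j.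
      by rewrite sj mulr1 sgK ler01.
    by rewrite mulr0; case: (s i) => [c|]//; rewrite mulr0.
  move=> /sb; rewrite !mxE !eqxx mulr1 /sg; case: b {sb sj} => /=;
    by rewrite ?mul1r ?mulr1 leNgt ltrN10.
by move: sj; case: (s j) => [c|_ ->]; rewrite ?mulr0//; case: b; case: c.
Qed.

(** For a cone contained in some orthant, the sign vector of the smallest
    orthant face that contains it. *)
Definition sign C : signs :=
  [ffun j => if side j true C && side j false C then None else Some (side j true C)].

Lemma signK s : sign (orthant s) = s.
Proof.
by apply/ffunP => j; rewrite ffunE !side_orthant; case: (s j) => [[]|].
Qed.

Definition within_orthant C := forall j, side j true C || side j false C.

Lemma le_orthant C s : within_orthant C ->
  (forall j b, s j = Some b -> side j b C) -> (forall j b, s j = None -> side j b C) ->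
  cone_set C `<=` orthant_set s.
Proof.
move=> wC sC nC x Cx j; case sj : (s j) => [b|]; first by apply: (sideP _ _ _ (sC _ _ sj)).
have /sideP/(_ _ Cx) := nC _ true sj; have /sideP/(_ _ Cx) := nC _ false sj.
by rewrite /sg mul1r mulN1r oppr_ge0 => le ge; apply/eqP; rewrite eq_le le ge.
Qed.

Lemma sign_side C j b : within_orthant C -> sign C j != Some (~~ b) -> side j b C.
Proof.
move=> /(_ j); rewrite ffunE; case: b;
  by case: (side j true C); case: (side j false C).
Qed.

Lemma le_sign C : within_orthant C -> cone_set C `<=` orthant_set (sign C).
Proof.
move=> wC; apply: le_orthant => // j b sj; apply: sign_side; rewrite ?sj//.
by case: b {sj}.
Qed.

Lemma within_orthantS C D : cone_set C `<=` cone_set D -> within_orthant D -> within_orthant C.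
Proof.
move=> CD wD j; have sideS b : side j b D -> side j b C.
  by move=> /sideP sD; apply/sideP => x /CD; exact: sD.
by case/orP: (wD j) => /sideS ->; rewrite ?orbT.
Qed.

Lemma orthant_within s : within_orthant (orthant s).
Proof. by move=> j; rewrite !side_orthant; case: (s j) => [[]|]. Qed.

Lemma sign_mono C D : cone_set C `<=` cone_set D -> within_orthant D ->
  orthant_set (sign C) `<=` orthant_set (sign D).
Proof.
move=> CD wD; have wC := within_orthantS CD wD.
apply: (@le_orthant (orthant (sign C))); first exact: orthant_within.
  move=> j b sD; rewrite side_orthant ffunE.
  have sb : side j b C.
    have /sideP sD' : side j b D by apply: sign_side => //; rewrite sD; case: b {sD}.
    by apply/sideP => x /CD; exact: sD'.
  by case: b sb {sD} => ->; [case: ifP|rewrite andbT; case: (side j true C)].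
move=> j b sD; rewrite side_orthant ffunE.
have sb c : side j c C.
  have /sideP sD' : side j c D by apply: sign_side => //; rewrite sD.
  by apply/sideP => x /CD; exact: sD'.
by rewrite !sb.
Qed.

End Orthants.

Arguments orthant R {d} s.

(** * Deforming the nonzero cones to the orthant faces *)

Section Order.
Variables (R : realType) (d : nat).
Hypothesis inclusion_order : forall C D : cone R d,
       cone_set C `<` cone_set D -> (C < D)%O.
Notation V := 'rV[R]_d.
Implicit Types (A : set V) (C D : cone R d) (x y : V) (j : 'I_d).

(** The assumption on the order enters through this equivalence only. *)
Lemma le_coneP C D : (C <= D)%O <-> cone_set C `<=` cone_set D.
Proof.
split=> [|CD].
  by rewrite le_eqVlt => /predU1P[->//|/asboolP/cone_lt_proper[]].
have [DC|nDC] := pselect (cone_set D `<=` cone_set C).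
  by rewrite (_ : C = D)//; apply: cone_eq; exact/seteqP.
exact/ltW/inclusion_order.
Qed.

Lemma zero_cone_le C : (zero_cone R d <= C)%O.
Proof. by apply/le_coneP => x ->; exact: cone0. Qed.

Lemma le_zero_cone C : (C <= zero_cone R d)%O -> C = zero_cone R d.
Proof. by move=> C0; apply/eqP; rewrite eq_le C0 zero_cone_le. Qed.

Definition nonzero : set (cone R d) := Cones R d `\ zero_cone R d.

Lemma nonzeroP C x : cone_set C x -> x <> 0 -> nonzero C.
Proof. by move=> Cx x0; split=> // C0; apply: x0; move: Cx; rewrite C0. Qed.

Lemma nonzeroW C D : nonzero C -> (C <= D)%O -> nonzero D.
Proof. by move=> [_ C0] CD; split=> // D0; apply: C0; apply: le_zero_cone; rewrite -D0. Qed.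

Definition part j b C := to_cone (halfcone j b C).
Definition wall j C := part j true (part j false C).

Lemma partE j b C : cone_set (part j b C) = halfcone j b C.
Proof. by rewrite to_coneE//; exact: halfcone_is_cone. Qed.

Lemma le_part j b C D : (C <= part j b D)%O = (C <= D)%O && side j b C.
Proof.
apply/idP/andP => [/le_coneP|[/le_coneP CD /sideP sC]].
  rewrite partE => CD; split; first by apply/le_coneP => x /CD[].
  by apply/sideP => x /CD[].
by apply/le_coneP => x Cx; rewrite partE; split; [exact: CD|exact: sC].
Qed.

Lemma le_wall j C D : (C <= wall j D)%O = [&& (C <= D)%O, side j true C & side j false C].
Proof. by rewrite !le_part -andbA [side j false C && _]andbC. Qed.

Lemma sideS j b C D : (C <= D)%O -> side j b D -> side j b C.
Proof. by move=> /le_coneP CD /sideP sD; apply/sideP => x /CD; exact: sD. Qed.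

Definition uncut k : set (cone R d) :=
  nonzero `&` [set C | forall j, (j < k)%N -> ~~ crossing (side j) C].

Lemma crossingS j C D : (C <= D)%O -> ~~ crossing (side j) D -> ~~ crossing (side j) C.
Proof.
by move=> CD; apply: contra => /andP[t f]; rewrite /crossing !(contra (sideS CD)).
Qed.

Lemma uncut_le k C D : (C <= D)%O -> nonzero C -> uncut k D -> uncut k C.
Proof. by move=> CD C0 [_ Dk]; split=> // j /Dk; exact: crossingS. Qed.

(** Cutting by one hyperplane only shrinks cones, so it preserves the property
    of not crossing the previous ones. *)
Lemma uncut_wall k j D : uncut k D -> crossing (side j) D -> uncut k (wall j D).
Proof.
move=> uD /andP[/sideP ct /sideP cf].
apply: (uncut_le _ _ uD); first by have := lexx (wall j D); rewrite le_wall => /and3P[].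
have [||z [Dz zj z0]] := @cross_wall _ _ j D.
- by move=> h; apply: ct => x /h; rewrite /sg mul1r.
- by move=> h; apply: cf => x /h; rewrite /sg mulN1r oppr_ge0.
apply: (nonzeroP _ z0); rewrite !partE /halfcone /=.
by rewrite zj !mulr0.
Qed.

Lemma uncut_part k j b D : uncut k D -> crossing (side j) D -> uncut k (part j b D).
Proof.
move=> uD cD; apply: (uncut_le _ _ uD).
  by have := lexx (part j b D); rewrite le_part => /andP[].
have [w0 _] := uncut_wall uD cD; apply: (nonzeroW w0).
have := lexx (wall j D); rewrite le_wall => /and3P[wD wt wf].
by rewrite le_part wD; case: b.
Qed.

Notation cs A := (closed_simplex A : set (realization R nonzero)).

Lemma cut_hyperplane j : deforms R (cs (uncut j)) (cs (uncut j.+1)).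
Proof.
have -> : uncut j.+1 = uncut j `&` [set C | ~~ crossing (side j) C].
  apply/seteqP; split=> C.
    by move=> [C0 Ck]; split; [split=> // i /ltnW; exact: Ck|exact: Ck].
  move=> [[C0 Ck] cj]; split=> // i; rewrite ltnS leq_eqVlt => /predU1P[ij|/Ck//].
  by rewrite (_ : i = j)//; exact: val_inj.
apply: (@cut_deforms _ _ _ nonzero (uncut j) (side j) (part j) (wall j)).
- by move=> C [].
- by move=> b C D _ _; exact: sideS.
- by move=> b D; exact: uncut_part.
- by move=> D; exact: uncut_wall.
- by move=> b C D _ _ _; exact: le_part.
- by move=> C D _ _ _; exact: le_wall.
Qed.

Lemma deforms_refl (A : set (cone R d)) : deforms R (cs A) (cs A).
Proof.
exists fst; split=> //; first by apply: continuous_subspaceT => z; exact: cvg_fst.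
by split.
Qed.

Lemma cut_all k : (k <= d)%N -> deforms R (cs (uncut 0)) (cs (uncut k)).
Proof.
elim: k => [_|k IHk kd]; first exact: deforms_refl.
exact: deforms_trans (IHk (ltnW kd)) (cut_hyperplane (Ordinal kd)).
Qed.

Definition orthants : set (cone R d) := uncut d `&` [set C | orthant R (sign C) = C].

Lemma uncut_within C : uncut d C -> within_orthant C.
Proof. by move=> [_ Cd] j; have := Cd j (ltn_ord j); rewrite /crossing -negb_or negbK. Qed.

Lemma within_uncut C : nonzero C -> within_orthant C -> uncut d C.
Proof. by move=> C0 wC; split=> // j _; rewrite /crossing -negb_or negbK. Qed.

(** After all cuts every cone lies in an orthant, and passing to the smallest
    orthant face is a closure operator there. *)
Lemma deforms_orthants : deforms R [set: realization R nonzero] (cs orthants).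
Proof.
have -> : [set: realization R nonzero] = cs (uncut 0).
  apply/seteqP; split=> x // _ C xC; split=> //.
  by have [_ _ + _] := bary_simplex x; apply.
apply: (deforms_trans (cut_all (leqnn d))).
have up C : uncut d C -> (C <= orthant R (sign C))%O.
  by move=> /uncut_within wC; apply/le_coneP; exact: le_sign.
apply: closure_deforms => //.
- by move=> C [].
- move=> C uC; apply: within_uncut; last exact: orthant_within.
  by have [C0 _] := uC; exact: nonzeroW (up _ uC).
- by move=> C D uC uD /le_coneP CD; apply/le_coneP/sign_mono => //; exact: uncut_within.
- by move=> C _; rewrite signK.
Qed.

Lemma orthant_nonzero s : nonzero (orthant R s) <-> s <> [ffun=> None].
Proof.
split=> [[_ s0] sE|sN].
  apply/s0/cone_eq/seteqP; split=> x; last by move=> ->; exact: cone0.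
  by move=> sx; apply/rowP => j; rewrite mxE; have := sx j; rewrite sE ffunE.
have [j [b sj]] : exists j b, s j = Some b.
  apply: contrapT => nj; apply: sN; apply/ffunP => j; rewrite ffunE.
  by case sj : (s j) => [b|//]; exfalso; apply: nj; exists j, b.
apply: (@nonzeroP _ (sg R b *: delta_mx ord0 j)).
  move=> i; rewrite !mxE eqxx /=; have [->|ij] := eqVneq i j.
    by rewrite sj mulr1 sgK ler01.
  by rewrite mulr0; case: (s i) => [c|]//; rewrite mulr0.
move=> /(congr1 (fun x : V => x ord0 j)); rewrite !mxE !eqxx mulr1 => /eqP.
by rewrite (negbTE (sg_neq0 R b)).
Qed.

Lemma orthantsP C : orthants C <-> nonzero C /\ exists s, C = orthant R s.
Proof.
split=> [[[C0 _] CE]|[C0 [s CE]]]; first by split=> //; exists (sign C).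
split; last by rewrite CE /mkset signK.
by apply: within_uncut => //; rewrite CE; exact: orthant_within.
Qed.

Lemma le_orthantP s s' : (orthant R s <= orthant R s')%O <->
  forall j b, s j = Some b -> s' j = Some b.
Proof.
split=> [ss' j b sj|ss'].
  have := @sideS j (~~ b) _ _ ss'; rewrite !side_orthant !negbK sj eqxx.
  by have [//|_ /(_ isT)] := eqVneq (s' j) (Some b).
apply/le_coneP => x sx j; have := sx j.
case sj : (s j) => [b|]; first by rewrite (ss' _ _ sj).
by move=> ->; case: (s' j) => [b|]; rewrite ?mulr0.
Qed.

End Order.

(** * Layers of a real vector *)

Section SignVectors.
Variables (R : realType) (d : nat).
Notation V := 'rV[R]_d.
Notation signs := {ffun 'I_d -> option bool}.
Implicit Types (s t : signs) (j : 'I_d) (v : V) (xi : signs -> R).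

(** The inclusion of orthant faces in terms of sign vectors. *)
Definition sle s t := [forall j, (s j != None) ==> (s j == t j)].

Lemma sleP s t : reflect (forall j b, s j = Some b -> t j = Some b) (sle s t).
Proof.
apply: (iffP forallP) => st j; first by move=> b sj; have := st j; rewrite sj => /eqP.
by apply/implyP; case sj : (s j) => [b|//] _; rewrite (st _ _ sj).
Qed.

Lemma sle_refl s : sle s s. Proof. exact/sleP. Qed.

Lemma sle_trans s t u : sle s t -> sle t u -> sle s u.
Proof. by move=> /sleP st /sleP tu; apply/sleP => j b /st /tu. Qed.

Definition rank s := #|[pred j | s j != None]|.

Lemma sle_rank s t : sle s t -> (rank t <= rank s)%N -> s = t.
Proof.
move=> st le; have sub : [pred j | s j != None] \subset [pred j | t j != None].
  apply/fintype.subsetP => j; rewrite !inE; case sj : (s j) => [b|//] _.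
  by rewrite (sleP _ _ st _ _ sj).
have eqr : rank s = rank t by apply/eqP; rewrite eqn_leq le subset_leq_card.
have E := subset_cardP eqr sub.
apply/ffunP => j; case sj : (s j) => [b|]; first by rewrite (sleP _ _ st _ _ sj).
by have := E j; rewrite !inE sj; case: (t j).
Qed.

Definition chain (N : pred signs) := forall s t, N s -> N t -> sle s t || sle t s.

Lemma chain_max (N : pred signs) s0 : chain N -> N s0 ->
  exists2 s, N s & forall t, N t -> sle t s.
Proof.
move=> cN N0; case: (@arg_maxnP _ s0 N rank N0) => s Ns smax; exists s => // t Nt.
case/orP: (cN _ _ Ns Nt) => // st; rewrite (sle_rank st) ?sle_refl//; exact: smax.
Qed.

Lemma chain_min (N : pred signs) s0 : chain N -> N s0 ->
  exists2 s, N s & forall t, N t -> sle s t.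
Proof.
move=> cN N0; case: (@arg_minnP _ s0 N rank N0) => s Ns smin; exists s => // t Nt.
case/orP: (cN _ _ Ns Nt) => // ts; rewrite (sle_rank ts) ?sle_refl//; exact: smin.
Qed.

Definition svec s : V := \row_j sgo R (s j).

(** The vertex of the face [s] is placed at the vector of signs; on a chain of
    sign vectors [combine xi] is then a sum of layers, the layer [s] having
    thickness [xi s] over the coordinates where [s] is nonzero. *)
Definition combine xi : V := \sum_s xi s *: svec s.

Lemma combineE xi j : combine xi ord0 j = \sum_s xi s * sgo R (s j).
Proof. by rewrite /combine summxE; apply: eq_bigr => s _; rewrite !mxE. Qed.

(** The default value of this minimum is harmless as it bounds all the terms. *)
Definition inner s v : R :=
  \big[Num.min/ \sum_j `|v ord0 j|]_(j | s j != None) (sgo R (s j) * v ord0 j).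
Definition outer s v : R := \big[Num.max/0]_(j | s j == None) `|v ord0 j|.
(** For [s] nonzero this is the measure of the levels [r > 0] such that [s] is
    the sign vector of the coordinates of [v] of absolute value at least [r]. *)
Definition layer s v : R := Num.max 0 (inner s v - outer s v).

Lemma normr_sg b (y : R) : `|sg R b * y| = `|y|.
Proof. by case: b; rewrite /sg ?mul1r// mulN1r normrN. Qed.

Lemma sgo_mul b o : sg R b * sgo R o = (o == Some b)%:R - (o == Some (~~ b))%:R.
Proof.
by case: o => [c|] /=; rewrite ?mulr0 ?subrr//; case: b; case: c;
  rewrite /sg ?mul1r ?mulN1r ?mulr1 ?opprK /= ?subr0 ?sub0r.
Qed.

(** Recovering the weights of a chain from the vector.  Write [a] and [b] for
    the total weight of the sign vectors above [s], with and without [s].  One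
    always has [inner s v <= a], tested on a coordinate of [s] where the
    largest vector of the chain not above [s] differs from [s], and
    [b <= outer s v], tested on a new coordinate of the smallest one strictly
    above [s].  If [s] has positive weight, it is comparable with the whole
    chain and both are equalities. *)
Lemma layer_combine xi s : (forall t, 0 <= xi t) -> chain [pred t | xi t != 0] ->
  s != [ffun=> None] -> layer s (combine xi) = xi s.
Proof.
move=> xi0 cxi sN.
have [j0 [b0 sj0]] : exists j b, s j = Some b.
  apply: contrapT => nj; case/eqP: sN; apply/ffunP => j; rewrite ffunE.
  by case sj : (s j) => [b|//]; exfalso; apply: nj; exists j, b.
set v := combine xi.
pose a := \sum_(t | sle s t) xi t.
pose b := \sum_(t | sle s t && (t != s)) xi t.
have aE : a = xi s + b by rewrite /a (bigD1 s) ?sle_refl.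
have coordE j c : sg R c * v ord0 j =
    \sum_t xi t * ((t j == Some c)%:R - (t j == Some (~~ c))%:R).
  rewrite combineE mulr_sumr; apply: eq_bigr => t _.
  by rewrite mulrCA sgo_mul.
have b_outer : b <= outer s v.
  have [->|bN] := eqVneq b 0; first exact: bigmax_ge_id.
  (* the vectors strictly above s have a smallest one t0, and every one of them
     contributes to a coordinate j where t0 differs from s *)
  pose N := [pred t | [&& xi t != 0, sle s t & t != s]].
  have [t1 Nt1] : exists t, N t.
    apply: contrapT => nN; case/eqP: bN; apply: big1 => t stN.
    by apply/eqP/negPn/negP => xt; apply: nN; exists t; rewrite /= xt.
  have cN : chain N by move=> t u /and3P[xt _ _] /and3P[xu _ _]; exact: cxi.
  have [t0 /and3P[xt0 st0 t0s] t0min] := chain_min cN Nt1.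
  have [j [c [sj tj]]] : exists j c, s j = None /\ t0 j = Some c.
    apply: contrapT => nj; case/eqP: t0s; apply/ffunP => j.
    case sj : (s j) => [c|]; first exact: (sleP _ _ st0).
    by case tj : (t0 j) => [c|//]; exfalso; apply: nj; exists j, c.
  apply: (@le_trans _ _ `|v ord0 j|); last first.
    by apply: le_bigmax_cond; rewrite sj.
  rewrite -(normr_sg c) (le_trans _ (ler_norm _))// coordE.
  rewrite /b big_mkcond; apply: ler_sum => t _.
  have [->|xt] := eqVneq (xi t) 0; first by rewrite mul0r if_same.
  case: ifPn => [/andP[st ts]|_].
    have tt0 : sle t0 t by apply: t0min; rewrite /= xt st.
    rewrite (sleP _ _ tt0 _ _ tj).
    by rewrite eqxx (_ : _ == _ = false) ?subr0 ?mulr1//; case: c {tj}.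
  apply: mulr_ge0 => //; case/orP: (cxi t t0 xt xt0) => [/sleP tt0|/sleP/(_ _ _ tj) ->].
    case tj' : (t j) => [e|]; last by rewrite /= subrr.
    have := tt0 _ _ tj'; rewrite tj => -[->].
    by rewrite eqxx; case: e {tj'}; rewrite /= subr0 ler01.
  by rewrite eqxx; case: c {tj}; rewrite /= subr0 ler01.
have inner_a : inner s v <= a.
  (* the vectors not above s have a largest one, and none of them contributes
     positively to a coordinate j where it differs from s *)
  pose N := [pred t | (xi t != 0) && ~~ sle s t].
  have [j [c [sj Nj]]] : exists j c, s j = Some c /\ forall t, N t -> t j != Some c.
    have [[t1 Nt1]|nN] := pselect (exists t, N t); last first.
      by exists j0, b0; split=> // t Nt; exfalso; apply: nN; exists t.
    have cN : chain N by move=> t u /andP[xt _] /andP[xu _]; exact: cxi.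
    have [t0 /andP[xt0 nst0] t0max] := chain_max cN Nt1.
    have [j [c [sj tj]]] : exists j c, s j = Some c /\ t0 j != Some c.
      apply: contrapT => nj; case/negP: nst0; apply/sleP => j c sj.
      by apply/eqP/negPn/negP => tj; apply: nj; exists j, c.
    exists j, c; split=> // t /t0max /sleP tt0.
    by apply: contra tj => /eqP /tt0 ->.
  apply: (@le_trans _ _ (sgo R (s j) * v ord0 j)).
    by apply: bigmin_le_cond; rewrite sj.
  rewrite sj /= coordE /a [leRHS]big_mkcond; apply: ler_sum => t _.
  have [->|xt] := eqVneq (xi t) 0; first by rewrite mul0r if_same.
  case: ifPn => st.
    by rewrite ler_piMr//; case: eqP => _; case: eqP => _; rewrite ?subrr ?subr0 ?sub0r//; lra.
  rewrite (negbTE (Nj t _)) /= ?xt ?st// sub0r mulrN oppr_le0 mulr_ge0//.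
have [xs|xs] := eqVneq (xi s) 0.
  rewrite /layer max_l// subr_le0 (le_trans inner_a)// (le_trans _ b_outer)//.
  by rewrite aE xs add0r.
have sa : inner s v = a.
  apply/eqP; rewrite eq_le inner_a/=.
  have aj j c : s j = Some c -> a <= sg R c * v ord0 j.
    move=> sj; rewrite coordE /a big_mkcond; apply: ler_sum => t _.
    have [->|xt] := eqVneq (xi t) 0; first by rewrite mul0r if_same.
    case: ifPn => [/sleP/(_ _ _ sj) ->|nst].
      by rewrite eqxx (_ : _ == _ = false) ?subr0 ?mulr1//; case: c {sj}.
    have := cxi s t xs xt; rewrite (negbTE nst)/= => /sleP ts.
    apply: mulr_ge0 => //; case tj : (t j) => [e|]; last by rewrite /= subrr.
    have := ts _ _ tj; rewrite sj => -[->].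
    by rewrite eqxx; case: e {tj}; rewrite /= subr0 ler01.
  apply: le_bigmin.
    apply: (le_trans (aj _ _ sj0)); apply: (le_trans (ler_norm _)); rewrite normr_sg.
    by rewrite (bigD1 j0)//= lerDl sumr_ge0.
  by move=> j; case sj : (s j) => [c|//] _; exact: aj.
have sb : outer s v = b.
  apply/eqP; rewrite eq_le b_outer andbT.
  apply: bigmax_le; first by apply: sumr_ge0.
  move=> j /eqP sj; rewrite -(normr_sg true) coordE (le_trans (ler_norm_sum _ _ _))//.
  rewrite /b [leRHS]big_mkcond; apply: ler_sum => t _.
  have [->|xt] := eqVneq (xi t) 0; first by rewrite mul0r normr0 if_same.
  rewrite normrM (ger0_norm (xi0 t)).
  case: ifPn => [_|].
    rewrite ler_piMr//; case: (t j) => [[]|] /=;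
      by rewrite ?subr0 ?sub0r ?normrN ?normr1 ?normr0.
  rewrite negb_and negbK => ts.
  have -> : t j = None; last by rewrite /= subrr normr0 mulr0.
  case/orP: ts => [nst|/eqP -> //].
  have := cxi s t xs xt; rewrite (negbTE nst)/= => /sleP ts.
  by case tj : (t j) => [e|//]; rewrite (ts _ _ tj) in sj.
by rewrite /layer sa sb aE addrK max_r.
Qed.

End SignVectors.

Section Decomposition.
Variables (R : realType) (d : nat).
Notation V := 'rV[R]_d.
Notation signs := {ffun 'I_d -> option bool}.
Implicit Types (s t : signs) (j : 'I_d) (v : V) (xi : signs -> R).

Definition vsign v : signs :=
  [ffun j => if v ord0 j == 0 then None else Some (0 < v ord0 j)].

Definition layered xi :=
  [/\ forall s, 0 <= xi s, chain [pred s | xi s != 0] & xi [ffun=> None] = 0].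

(** Peel off the layer of the full sign vector of [v], whose thickness is the
    smallest nonzero absolute value of a coordinate, and induct on the number
    of nonzero coordinates. *)
Lemma layer_decomposition v : exists xi, layered xi /\ combine xi = v.
Proof.
suff [xi [lxi xv _]] : exists xi, [/\ layered xi, combine xi = v &
    forall s, xi s != 0 -> sle s (vsign v)] by exists xi.
have [n le] := ubnP (rank (vsign v)); elim: n => // n IHn in v le *.
have [v0|[j0 vj0]] : v = 0 \/ exists j, v ord0 j != 0.
  have [[j vj]|nj] := pselect (exists j, v ord0 j != 0); [by right; exists j|left].
  apply/rowP => j; rewrite mxE; apply/eqP/negPn/negP => vj; apply: nj; by exists j.
  exists (fun=> 0); split; last by move=> s; rewrite eqxx.
    by split=> // s t; rewrite /= eqxx.
  by rewrite v0 /combine big1// => s _; rewrite scale0r.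
have [m vm mmin] : exists2 m, v ord0 m != 0 &
    forall j, v ord0 j != 0 -> `|v ord0 m| <= `|v ord0 j|.
  case: (@arg_minP _ _ _ j0 (fun j => v ord0 j != 0) (fun j => `|v ord0 j|) vj0) => m vm mm.
  by exists m.
pose mu := `|v ord0 m|.
have mu0 : 0 < mu by rewrite normr_gt0.
pose s0 := vsign v.
pose v' := v - mu *: svec R s0.
have v'E j : v' ord0 j = v ord0 j - mu * sgo R (s0 j) by rewrite !mxE.
have s0E j : v ord0 j != 0 -> s0 j = Some (0 < v ord0 j) by rewrite ffunE => /negbTE ->.
have ss : sle (vsign v') s0.
  apply/sleP => j b; rewrite [vsign v' j]ffunE v'E.
  have [vj|vj] := eqVneq (v ord0 j) 0.
    by rewrite ffunE vj eqxx /= mulr0 subr0 eqxx.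
  rewrite s0E//; have := mmin _ vj; rewrite -/mu /= /sg.
  case: (ltrgt0P (v ord0 j)) vj => // vj _; rewrite ?mulr1 ?mulrN1 => muv.
    by case: ifPn => // nz [<-]; rewrite lt_def nz subr_ge0 muv.
  by rewrite opprK; case: ifPn => // nz [<-]; congr Some;
    apply/esym/negbTE; rewrite -leNgt; lra.
(* the coordinate m vanishes in v', so the rank drops *)
have v'm : vsign v' m = None.
  rewrite ffunE v'E s0E//= /sg /mu; case: (ltrgt0P (v ord0 m)) vm => // vm' _.
    by rewrite mulr1 subrr eqxx.
  by rewrite mulrN1 opprK subrr eqxx.
have s0N : s0 != [ffun=> None].
  by apply/eqP => /ffunP/(_ m); rewrite s0E// ffunE.
have rk : (rank (vsign v') < rank s0)%N.
  rewrite ltnNge; apply/negP => /(sle_rank ss)/ffunP/(_ m).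
  by rewrite v'm s0E.
have [xi [[xi0 cxi xiN] xiv xis]] := IHn v' (leq_trans rk le).
exists (fun s => xi s + (if s == s0 then mu else 0)); split.
- split.
  + by move=> s; rewrite addr_ge0//; case: ifP => // _; exact: ltW.
  + have le0 s : xi s + (if s == s0 then mu else 0) != 0 -> s = s0 \/ xi s != 0.
      by case: (s =P s0) => [->|_]; [left|rewrite addr0; right].
    move=> s t /= /le0 s1 /le0 t1.
    case: s1 => [->|xs]; case: t1 => [->|xt]; first by rewrite sle_refl.
    * by rewrite (sle_trans (xis _ xt) ss) orbT.
    * by rewrite (sle_trans (xis _ xs) ss).
    * exact: cxi.
  + by rewrite xiN eq_sym (negbTE s0N) addr0.
- rewrite /combine; under eq_bigr do rewrite scalerDl.
  rewrite big_split/= -/(combine xi) xiv (bigD1 s0)//= eqxx big1 ?addr0 ?subrK//.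
  by move=> s /negbTE ->; rewrite scale0r.
- move=> s; case: (s =P s0) => [->|_]; first by rewrite sle_refl.
  by rewrite addr0 => /xis xs; exact: sle_trans ss.
Qed.

Lemma bigmin_scale c (I : finType) (p : pred I) (x : R) (f : I -> R) : 0 <= c ->
  \big[Num.min/c * x]_(i | p i) (c * f i) = c * \big[Num.min/x]_(i | p i) f i.
Proof.
by move=> c0; elim/big_rec2: _ => // i a b _ ->; rewrite minr_pMr.
Qed.

Lemma bigmax_scale c (I : finType) (p : pred I) (x : R) (f : I -> R) : 0 <= c ->
  \big[Num.max/c * x]_(i | p i) (c * f i) = c * \big[Num.max/x]_(i | p i) f i.
Proof.
by move=> c0; elim/big_rec2: _ => // i a b _ ->; rewrite maxr_pMr.
Qed.

Lemma layerZ c s v : 0 <= c -> layer s (c *: v) = c * layer s v.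
Proof.
move=> c0; rewrite /layer maxr_pMr// mulr0 mulrBr /inner /outer.
congr (Num.max 0 (_ - _)).
  rewrite -bigmin_scale// mulr_sumr; congr bigop.body; last first.
    by apply/funext => j; rewrite mxE mulrCA.
  by apply: eq_bigr => j _; rewrite mxE normrM ger0_norm.
rewrite -bigmax_scale// mulr0; apply: eq_bigr => j _.
by rewrite mxE normrM ger0_norm.
Qed.

Lemma cvg_bigmin (U : Type) (F : set_system U) (FF : Filter F) (I : Type) (r : seq I)
    (p : pred I) (x : U -> R) (f : U -> I -> R) x0 f0 :
  x z @[z --> F] --> x0 -> (forall i, f z i @[z --> F] --> f0 i) ->
  \big[Num.min/x z]_(i <- r | p i) f z i @[z --> F] -->
  \big[Num.min/x0]_(i <- r | p i) f0 i.
Proof.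
move=> xx ff; elim: r => [|i r IHr].
  by rewrite big_nil; under eq_fun do rewrite big_nil.
rewrite big_cons; under eq_fun do rewrite big_cons.
by case: (p i) => //; apply: cvg_minr.
Qed.

Lemma cvg_layer s (U : Type) (F : set_system U) (FF : Filter F) (f : U -> V) v :
  (forall j, f z ord0 j @[z --> F] --> v ord0 j) ->
  layer s (f z) @[z --> F] --> layer s v.
Proof.
move=> fv; apply: cvg_maxr; first exact: cvg_cst.
have fn j : `|f z ord0 j| @[z --> F] --> `|v ord0 j| by apply: cvg_norm; exact: fv.
apply: cvgB.
  apply: cvg_bigmin; last by move=> j; apply: cvgM; [exact: cvg_cst|exact: fv].
  apply: cvg_big => // z; apply: cvgD; [exact: cvg_fst|exact: cvg_snd].
by apply: cvg_big => //; exact: max_continuous.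
Qed.

End Decomposition.

(** * The realization of the orthant faces is a sphere *)

Lemma cvg_row (R : realType) (d : nat) (I : Type) (F : set_system I) (FF : Filter F)
    (f : I -> 'rV[R]_d) (v : 'rV[R]_d) :
  (forall j, f z ord0 j @[z --> F] --> v ord0 j) -> f z @[z --> F] --> v.
Proof.
move=> fv A [B /= nB BA].
have : \forall z \near F, forall j, B ord0 j (f z ord0 j).
  by apply: filter_forall => j; apply: fv; exact: nB.
by apply: filterS => z zB; apply: BA => i j; rewrite ord1.
Qed.

Section Subspaces.
Variables (T U : topologicalType) (A : set T) (B : set U).

Lemma homeomorphic_restrict (f : T -> U) (g : U -> T) :
  (forall x, A x -> B (f x)) -> (forall y, B y -> A (g y)) ->
  (forall x, A x -> g (f x) = x) -> (forall y, B y -> f (g y) = y) ->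
  {within A, continuous f} -> {within B, continuous g} ->
  homeomorphic (set_type A) (set_type B).
Proof.
move=> fAB gBA gf fg fc gc.
exists (fun a : set_type A => exist _ (f (set_val a)) (mem_set (fAB _ (set_valP a)))).
exists (fun b : set_type B => exist _ (g (set_val b)) (mem_set (gBA _ (set_valP b)))).
split.
- by apply: continuous_comp_initial; exact: ((subspace_sigL_continuousP _ _).1 fc).
- by apply: continuous_comp_initial; exact: ((subspace_sigL_continuousP _ _).1 gc).
- by move=> a; apply: val_inj; exact/gf/set_valP.
- by move=> b; apply: val_inj; exact/fg/set_valP.
Qed.

End Subspaces.

Section Sphere.
Variables (R : realType) (d : nat).
Notation V := 'rV[R]_d.
Implicit Types (v : V) (j : 'I_d).

Definition norm2 v : R := Num.sqrt (\sum_j v ord0 j ^+ 2).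

Definition direction v : V := (norm2 v)^-1 *: v.

Lemma norm2_gt0 v : v <> 0 -> 0 < norm2 v.
Proof.
move=> v0; rewrite sqrtr_gt0 lt_def sumr_ge0 ?andbT => [|j _]; last exact: sqr_ge0.
apply/eqP => /eqP; rewrite psumr_eq0 => [|j _]; last exact: sqr_ge0.
move=> /allP vj; apply: v0; apply/rowP => j; rewrite mxE.
by have := vj j; rewrite mem_index_enum sqrf_eq0 => /(_ isT)/eqP.
Qed.

Lemma direction_sphere v : v <> 0 -> unit_sphere R d (direction v).
Proof.
move=> v0; have n0 := norm2_gt0 v0.
rewrite /unit_sphere /mkset; under eq_bigr do rewrite mxE exprMn.
rewrite -mulr_sumr -[X in _ * X]sqr_sqrtr -/(norm2 v); last first.
  by apply: sumr_ge0 => j _; exact: sqr_ge0.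
by rewrite -exprMn mulVf ?expr1n// gt_eqF.
Qed.

Lemma direction_id v c : 0 < c -> unit_sphere R d v -> direction (c *: v) = v.
Proof.
move=> c0 vS; rewrite /direction /norm2; under eq_bigr do rewrite mxE exprMn.
rewrite -mulr_sumr (vS : _ = 1) mulr1 sqrtr_sqr gtr0_norm// scalerA mulVf ?scale1r//.
by rewrite gt_eqF.
Qed.

Lemma sphere_neq0 v : unit_sphere R d v -> v <> 0.
Proof.
move=> + v0; rewrite v0 /unit_sphere /mkset big1 => [/esym/eqP|j _].
  by rewrite oner_eq0.
by rewrite mxE expr0n.
Qed.

Lemma cvg_direction (I : Type) (F : set_system I) (FF : Filter F) (f : I -> V) v :
  v <> 0 -> (forall j, f z ord0 j @[z --> F] --> v ord0 j) ->
  direction (f z) @[z --> F] --> direction v.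
Proof.
move=> v0 fv; apply: cvg_row => j; rewrite mxE; under eq_fun do rewrite mxE.
apply: cvgM; last exact: fv.
apply: cvgV; first by rewrite gt_eqF// norm2_gt0.
apply: (@cvg_comp _ _ _ _ Num.sqrt); last exact: sqrt_continuous.
apply: cvg_big => [z|i _]; first by apply: cvgD; [exact: cvg_fst|exact: cvg_snd].
by rewrite expr2; under eq_fun do rewrite expr2; apply: cvgM; exact: fv.
Qed.

End Sphere.

Section SphereHomeo.
Variables (R : realType) (d : nat).
Hypothesis inclusion_order : forall C D : cone R d,
       cone_set C `<` cone_set D -> (C < D)%O.
Notation V := 'rV[R]_d.
Notation T := (realization R (@nonzero R d)).
Notation cs A := (closed_simplex A : set T).
Notation orthants := (@orthants R d).
Variable x0 : T.
Implicit Types (x : T) (v : V) (C : cone R d).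

Definition place x : V := combine (fun s => bary x (orthant R s)).

Definition layers v C : R := if `[< orthants C >] then layer (sign C) v else 0.

Lemma finite_orthants : finite_set orthants.
Proof.
apply: (@sub_finite_set _ _ ((fun s => orthant R s) @` setT)).
  by move=> C /orthantsP[_ [s ->]]; exists s.
exact/finite_image/finite_finset.
Qed.

Lemma orthant_orthants s : orthants (orthant R s) <-> s <> [ffun=> None].
Proof.
rewrite -orthant_nonzero.
split=> [/orthantsP[s0 _]|s0]; [exact: s0|apply/orthantsP].
by split=> //; exists s.
Qed.

Lemma sle_comparable (s t : {ffun 'I_d -> option bool}) :
  (orthant R s >=< orthant R t)%O = sle s t || sle t s.
Proof.
have leE (u w : {ffun 'I_d -> option bool}) : (orthant R u <= orthant R w)%O = sle u w.
  by apply/idP/idP =>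
    [/(le_orthantP inclusion_order)/sleP|/sleP/(le_orthantP inclusion_order)].
by rewrite /Order.comparable !leE.
Qed.

Lemma layers_place x : cs orthants x -> layers (place x) = bary x.
Proof.
move=> xo; apply/funext => C; rewrite /layers; case: asboolP => [oC|nC]; last first.
  by apply/esym/suppN => /xo.
have [_ [s CE]] := (orthantsP C).1 oC.
rewrite CE signK layer_combine//.
- by move=> t; exact: bary_ge0.
- by move=> t u xt xu; rewrite -sle_comparable; exact: supp_comparable xt xu.
- by apply/eqP/orthant_orthants; rewrite -CE.
Qed.

Lemma layersZ c v C : 0 <= c -> layers (c *: v) C = c * layers v C.
Proof. by move=> c0; rewrite /layers; case: ifP => _; rewrite ?layerZ ?mulr0. Qed.

Lemma layers0 C : layers 0 C = 0.
Proof. by rewrite -(scale0r (0 : V)) layersZ ?mul0r. Qed.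

Lemma place_neq0 x : cs orthants x -> place x <> 0.
Proof.
move=> /layers_place + p0; have [C xC] := bary_ex x.
by move=> /(congr1 (fun f => f C)); rewrite p0 layers0 => /esym/eqP; apply/negP.
Qed.

(** Surjectivity of [place] up to scaling, from the layer decomposition. *)
Lemma place_onto v : v <> 0 ->
  exists x c, [/\ cs orthants x, 0 < c & place x = c *: v].
Proof.
move=> v0; have [xi [[xi0 cxi xiN] xiv]] := layer_decomposition v.
pose w C : R := if `[< orthants C >] then xi (sign C) else 0.
have wE s : w (orthant R s) = xi s.
  rewrite /w signK; case: asboolP => // /orthant_orthants/contrapT ->.
  by rewrite xiN.
have wo C : supp w C -> orthants C by rewrite /supp /w /=; case: asboolP; rewrite ?eqxx.
have aw : admissible (@nonzero R d) w.
  split; first by move=> C; rewrite /w; case: ifP.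
  split.
  - have [s xs] : exists s, xi s != 0.
      apply: contrapT => ns; apply: v0; rewrite -xiv /combine big1// => s _.
      have [->|xs] := eqVneq (xi s) 0; first by rewrite scale0r.
      by exfalso; apply: ns; exists s.
    by exists (orthant R s); rewrite /supp /mkset wE.
  - exact: sub_finite_set finite_orthants.
  - by move=> C /wo/orthantsP[].
  - move=> C D wC wD.
    have [_ [s CE]] := (orthantsP C).1 (wo _ wC).
    have [_ [t DE]] := (orthantsP D).1 (wo _ wD).
    move: wC wD; rewrite /supp /mkset CE DE !wE sle_comparable; exact: cxi.
exists (normalize x0 w), (\sum_(C \in [set: cone R d]) w C)^-1; split.
- by move=> C /(supp_normalize aw)/wo.
- by rewrite invr_gt0; exact: total_gt0 aw.
- rewrite -xiv /place /combine scaler_sumr; apply: eq_bigr => s _.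
  by rewrite normalizeE// wE scalerA mulrC.
Qed.

(** The layers of a vector are homogeneous in it, so normalizing them inverts
    [place] regardless of the scale. *)
Lemma layers_of_place x v c : cs orthants x -> 0 < c -> place x = c *: v ->
  admissible (@nonzero R d) (layers v) /\ normalize x0 (layers v) = x.
Proof.
move=> xo c0 xv.
have lE : layers v = fun C => c^-1 * bary x C.
  apply/funext => C; rewrite -(layers_place xo) xv layersZ ?ltW// mulrA mulVf ?mul1r//.
  by rewrite gt_eqF.
have [b0 sb] := admissible_bary x.
have ci : 0 < c^-1 by rewrite invr_gt0.
have av : admissible (@nonzero R d) (layers v).
  rewrite lE; split; first by move=> C; rewrite mulr_ge0// ltW.
  rewrite (_ : supp _ = supp (bary x))//; apply/seteqP.
  by split=> C /=; rewrite /supp /= mulf_eq0 negb_or (gt_eqF ci).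
split=> //; apply: realization_eq => C; rewrite normalizeE// lE.
by rewrite -mulr_fsumr bary_sum1 mulr1 mulrAC divff ?mul1r// gt_eqF.
Qed.

Lemma cvg_place (F : set_system T) (FF : Filter F) x j :
  F --> x -> place z ord0 j @[z --> F] --> place x ord0 j.
Proof.
move=> Fx; rewrite /place combineE; under eq_fun do rewrite combineE.
apply: cvg_big => [z|s _]; first by apply: cvgD; [exact: cvg_fst|exact: cvg_snd].
apply: cvgM; last exact: cvg_cst.
exact: (cvg_trans (cvg_app _ Fx) (@bary_continuous _ _ _ _ _ x)).
Qed.

Lemma layers_continuous v C : layers u C @[u --> v] --> layers v C.
Proof.
rewrite /layers; case: ifP => _.
  by apply: (@cvg_layer _ _ _ _ (nbhs v) (nbhs_filter v)) => j; exact: coord_continuous.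
exact: (@cvg_cst _ 0 _ (nbhs v) (nbhs_filter v)).
Qed.

(** The two inverse maps are the direction of [place x] and the normalized
    layers of a unit vector. *)
Lemma orthants_sphere : homeomorphic (set_type (cs orthants)) (set_type (unit_sphere R d)).
Proof.
have adm v : unit_sphere R d v -> admissible (@nonzero R d) (layers v) /\
    exists x c, [/\ cs orthants x, 0 < c, place x = c *: v & normalize x0 (layers v) = x].
  move=> /sphere_neq0/place_onto[x [c [xo c0 xv]]].
  have [av nv] := layers_of_place xo c0 xv.
  by split=> //; exists x, c.
apply: (@homeomorphic_restrict _ _ _ _ (fun x => direction (place x))
  (fun v => normalize x0 (layers v))).
- by move=> x xo; exact/direction_sphere/place_neq0.
- by move=> v /adm[_ [x [c [xo _ _ ->]]]].
- move=> x xo; have n0 := norm2_gt0 (place_neq0 xo).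
  apply: (layers_of_place xo n0 _).2.
  by rewrite /direction scalerA divff ?scale1r// gt_eqF.
- by move=> v vS; have [_ [x [c [xo c0 xv ->]]]] := adm v vS; rewrite xv direction_id.
- apply/subspace_continuousP => x xo; apply: cvg_within_filter.
  apply: (@cvg_direction _ _ _ (nbhs x) (nbhs_filter x)); first exact: place_neq0.
  by move=> j; apply: (@cvg_place (nbhs x) (nbhs_filter x)).
- apply/subspace_continuousP => v vS.
  apply: (@cvg_normalize _ _ _ _ _ _ _ orthants (fun=> x0)
    (fun u => layers u) x0 _ finite_orthants).
  + by have [] := adm v vS.
  + by move=> C; rewrite /supp /layers /=; case: asboolP; rewrite ?eqxx.
  + apply: (@filterS _ (within (unit_sphere R d) (nbhs v)) _ (unit_sphere R d));
      last exact: withinT.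
    move=> u /adm[au _]; split=> // C.
    by rewrite /supp /layers /=; case: asboolP; rewrite ?eqxx.
  + by move=> C; apply: cvg_within_filter; exact: layers_continuous.
Qed.

End SphereHomeo.

(** * Contractible posets of cones *)

Section Points.
Variables (R : realType) (disp : Order.disp_t) (P : porderType disp).
Variable S : set P.
Notation T := (realization R S).
Notation cs A := (closed_simplex A : set T).

Lemma fsum_point c (f : P -> R) : (forall p, p <> c -> f p = 0) ->
  \sum_(p \in [set: P]) f p = f c.
Proof.
by move=> f0; rewrite (fsumTE (finite_set1 c))// fset_set1 big_seq_fset1.
Qed.

Lemma vertex_exists c : S c -> exists x : T, cs [set c] x.
Proof.
move=> Sc; pose w p : R := (p == c)%:R.
have wc : [set p | w p != 0] = [set c].
  by apply/seteqP; split=> p; rewrite /w /= pnatr_eq0 eqb0 negbK => /eqP.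
have w0 p : 0 <= w p by exact: ler0n.
have sw : simplex S [set p | w p != 0].
  rewrite wc; split; first by exists c.
  - exact: finite_set1.
  - by move=> p ->.
  - by move=> p q -> ->; exact: comparablexx.
have w1 : \sum_(p \in [set: P]) w p = 1.
  have wN p : p <> c -> w p = 0 by rewrite /w => /eqP/negbTE ->.
  by rewrite (fsum_point wN) /w eqxx.
by exists (Realization w0 sw w1) => p; rewrite -wc.
Qed.

Lemma vertex_unique c (x y : T) : cs [set c] x -> cs [set c] y -> x = y.
Proof.
have x1 (z : T) : cs [set c] z -> z c = 1.
  move=> zc; have zN p : p <> c -> z p = 0 by move=> np; apply: suppN => /zc.
  by rewrite -(bary_sum1 z) (fsum_point zN).
move=> xc yc; apply: realization_eq => p.
have [->|/eqP pc] := eqVneq p c; first by rewrite !x1.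
by rewrite !(@suppN _ _ _ _ p)//; [move=> /yc|move=> /xc].
Qed.

Lemma closed_simplex_full : cs S = [set: T].
Proof.
apply/seteqP; split=> x // _ p xp.
by have [_ _ + _] := bary_simplex x; apply.
Qed.

Lemma contractible_vertex c : S c -> deforms R [set: T] (cs [set c]) -> contractible R T.
Proof.
move=> Sc [H [Hc H0 _ H1 _]]; have [x xc] := vertex_exists Sc.
exists x, H; split=> // y; first exact: H0.
by apply: vertex_unique xc; exact: H1.
Qed.

End Points.

Section Positive.
Variables (R : realType) (d : nat) (d_gt0 : (0 < d)%N).
Hypothesis inclusion_order : forall C D : cone R d,
       cone_set C `<` cone_set D -> (C < D)%O.
Notation V := 'rV[R]_d.
Implicit Types (C D : cone R d) (x : V).

Lemma zero_cone_pos : Cones_pos R d (zero_cone R d).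
Proof. by move=> x ->; right. Qed.

Notation last := (Ordinal (etrans (ltn_predL d) d_gt0)).

Lemma pos_gt0 C x : Cones_pos R d C -> cone_set C x -> x <> 0 -> 0 < x ord0 last.
Proof. by move=> Cp /Cp[|//] + _; apply; rewrite /= prednK. Qed.

Lemma last_unique (i : 'I_d) : i.+1 = d -> i = last.
Proof. by move=> /(congr1 predn) id; apply: val_inj. Qed.

Definition up : V := delta_mx ord0 last.

Lemma up_neq0 : up <> 0.
Proof.
by move=> /(congr1 (fun x : V => x ord0 last)); rewrite !mxE !eqxx => /eqP; rewrite oner_eq0.
Qed.

(** The Minkowski sum of [C] and the vertical ray. *)
Definition raised_set C : set V :=
  [set y | exists x a, [/\ cone_set C x, 0 <= a & y = x + a *: up]].

Lemma raised_pos C y : Cones_pos R d C -> raised_set C y -> y <> 0 -> 0 < y ord0 last.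
Proof.
move=> Cp [x [a [Cx a0 ->]]] y0; rewrite !mxE !eqxx mulr1.
have [x0|x0] := pselect (x = 0).
  move: y0; rewrite x0 add0r mxE add0r lt_def a0 andbT => y0.
  by apply/eqP => aE; apply: y0; rewrite aE scale0r.
by rewrite ltr_wpDr//; exact: pos_gt0 Cp Cx x0.
Qed.

(** Pointedness is where positivity is needed: a nonzero vector of the sum has
    positive last coordinate. *)
Lemma raised_is_cone C : Cones_pos R d C -> is_cone (raised_set C).
Proof.
move=> Cp; have [n [g [gZ Cg]]] := cone_hull C.
apply: (@is_cone_hull _ _ _ (fun o : option 'I_n => if o is Some i then g i else up)).
- by case=> [i|]; [exact: gZ|move=> i; rewrite mxE rpred_nat].
- set g' := fun o : option 'I_n => _; apply/seteqP; split=> y.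
    move=> [x [a [+ a0 ->]]]; rewrite Cg => -[b b0 ->]; apply: hullD.
      by apply: hull_sum => i _; apply: hullZ => //; exact: (hull_gen g' (Some i)).
    by apply: hullZ => //; exact: (hull_gen g' None).
  move=> [b b0 ->]; elim/big_ind: _ => [||[i|] _].
  + by exists 0, 0; rewrite scale0r addr0; split=> //; exact: cone0.
  + move=> u v [x [a [Cx a0 ->]]] [z [c [Cz c0 ->]]].
    exists (x + z), (a + c); split; [exact: coneD|exact: addr_ge0|].
    by rewrite scalerDl addrACA.
  + exists (b (Some i) *: g i), 0; rewrite scale0r addr0; split=> //.
    by apply: coneZ => //; rewrite Cg; exact: hull_gen.
  + by exists 0, (b None); rewrite add0r; split=> //; exact: cone0.
- move=> y ry rny; apply: contrapT => y0; have := raised_pos Cp ry y0.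
  have : - y <> 0 by move=> /eqP; rewrite oppr_eq0 => /eqP.
  by move=> /(raised_pos Cp rny); rewrite mxE; lra.
Qed.

Definition raised C : cone R d := to_cone (raised_set C).

Lemma raisedE C : Cones_pos R d C -> cone_set (raised C) = raised_set C.
Proof. by move=> Cp; rewrite to_coneE//; exact: raised_is_cone. Qed.

Definition ray : cone R d := raised (zero_cone R d).

Lemma rayE : cone_set ray = [set y | exists2 a, 0 <= a & y = a *: up].
Proof.
rewrite raisedE//; last exact: zero_cone_pos.
apply/seteqP; split=> y.
  by move=> [x [a [/= -> a0 ->]]]; exists a; rewrite ?add0r.
by move=> [a a0 ->]; exists 0, a; rewrite add0r.
Qed.

Lemma raised_Cones_pos C : Cones_pos R d C -> Cones_pos R d (raised C).
Proof.
move=> Cp y; rewrite raisedE// => ry; have [->|y0] := pselect (y = 0); [by right|left].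
by move=> i /last_unique ->; exact: raised_pos ry y0.
Qed.

Definition positive : set (cone R d) := Cones_pos R d `\ zero_cone R d.

Lemma ray_le_raised C : Cones_pos R d C -> (ray <= raised C)%O.
Proof.
move=> Cp; apply/(le_coneP inclusion_order); rewrite rayE raisedE// => y [a a0 ->].
by exists 0, a; rewrite add0r; split=> //; exact: cone0.
Qed.

Lemma le_raised C : Cones_pos R d C -> (C <= raised C)%O.
Proof.
move=> Cp; apply/(le_coneP inclusion_order); rewrite raisedE// => y Cy.
by exists y, 0; rewrite scale0r addr0.
Qed.

Lemma positive_nonzero C : positive C <-> Cones_pos R d C /\ nonzero C.
Proof. by split=> [[Cp C0]|[Cp [_ C0]]]. Qed.

Lemma raised_positive C : Cones_pos R d C -> positive (raised C).
Proof.
move=> Cp; apply/positive_nonzero; split; first exact: raised_Cones_pos.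
apply: (@nonzeroP _ _ _ up); last exact: up_neq0.
by rewrite raisedE//; exists 0, 1; rewrite scale1r add0r; split=> //; exact: cone0.
Qed.

Lemma raised_mono C D : Cones_pos R d C -> Cones_pos R d D -> (C <= D)%O ->
  (raised C <= raised D)%O.
Proof.
move=> Cp Dp /(le_coneP inclusion_order) CD; apply/(le_coneP inclusion_order).
rewrite !raisedE// => y [x [a [Cx a0 ->]]].
by exists x, a; split=> //; exact: CD.
Qed.

Lemma raised_idem C : Cones_pos R d C -> raised (raised C) = raised C.
Proof.
move=> Cp; have rp := raised_Cones_pos Cp.
apply/eqP; rewrite eq_le le_raised// andbT; apply/(le_coneP inclusion_order).
rewrite [cone_set (raised (raised C))]raisedE// => _ [x [b [+ b0 ->]]].
rewrite raisedE// => -[z [a [Cz a0 ->]]].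
by exists z, (a + b); split=> //; [exact: addr_ge0|rewrite scalerDl addrA].
Qed.

(** Adding the vertical ray deforms the poset to the cones that contain the
    ray, of which the ray itself is the smallest. *)
Lemma contractible_positive : contractible R (realization R positive).
Proof.
have zp := zero_cone_pos.
have pos C : positive C -> Cones_pos R d C by case.
have fixed_ray : (positive `&` [set C | raised C = C]) ray.
  by split; [exact: raised_positive|exact: raised_idem].
apply: (@contractible_vertex _ _ _ _ ray); first by case: fixed_ray.
apply: (@deforms_trans _ _ _ (closed_simplex (positive `&` [set C | raised C = C]))).
  rewrite -closed_simplex_full; apply: closure_deforms => //.
  - by move=> C /pos; exact: raised_positive.
  - by move=> C /pos; exact: le_raised.
  - by move=> C D /pos Cp /pos Dp; exact: raised_mono.
  - by move=> C /pos; exact: raised_idem.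
apply: cone_point_deforms => //.
by move=> C [/pos Cp <-]; exact: ray_le_raised.
Qed.

Lemma contractible_minimum (S : set (cone R d)) : S (zero_cone R d) ->
  contractible R (realization R S).
Proof.
move=> S0; apply: (contractible_vertex S0); rewrite -closed_simplex_full.
by apply: cone_point_deforms => // C _; exact: zero_cone_le.
Qed.

End Positive.

(** * The whole space as a filtered union *)

Section WholeSpace.
Variables (R : realType) (T : topologicalType).

Definition in_whole (x : T) : set_type [set: T] := exist _ x (mem_set I).

Lemma filtered_union_whole : filtered_union [set [set: T]].
Proof.
split.
- by exists setT.
- by move=> X Y -> ->; exists setT.
- by apply/seteqP; split=> x // _; exists setT.
- move=> U /(_ setT erefl) [W oW WU]; rewrite (_ : U = W)//.
  have UW x : W x = U x.
    exact: (congr1 (fun A : set (set_type [set: T]) => A (in_whole x)) WU).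
  by apply/funext => x; rewrite UW.
Qed.

Lemma deforms_whole (A : set T) : deforms R [set: T] A ->
  strong_deformation_retract R (set_val @^-1` A : set (set_type [set: T])).
Proof.
move=> [H [Hc H0 _ H1 [_ HA]]].
exists (fun z => in_whole (H (set_val z.1, z.2))); split => //.
- apply: continuous_comp_initial; apply/subspace_continuousP => -[x t] [_ /= t01].
  apply: (@within_comp (set_type [set: T] * R)%type (T * R)%type T
    ([set: set_type [set: T]] `*` `[0, 1]) ([set: T] `*` `[0, 1])
    (fun z => (set_val z.1, z.2)) H (x, t) (H (set_val x, t))).
  + by move=> [y u] [_ /= u01].
  + apply: cvg_within_filter; apply: cvg_pairT; last exact: cvg_snd.
    by apply: (@cvg_comp _ _ _ fst set_val _ (nbhs x));
      [exact: cvg_fst|exact: initial_continuous].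
  + by move/subspace_continuousP : Hc; apply.
- by move=> x; apply: val_inj; exact: H0.
- by move=> x; exact: H1.
- by move=> a t Aa t01; apply: val_inj; exact: HA.
Qed.

Lemma homeomorphic_whole (A : set T) (U : topologicalType) (B : set U) :
  homeomorphic (set_type A) (set_type B) ->
  homeomorphic (set_type (set_val @^-1` A : set (set_type [set: T]))) (set_type B).
Proof.
move=> [f [g [fc gc gf fg]]].
pose W := set_type (set_val @^-1` A : set (set_type [set: T])).
pose lower (a : W) : set_type A := exist _ (set_val (set_val a)) (mem_set (set_valP a)).
have liftP (a : set_type A) : (set_val @^-1` A) (in_whole (set_val a)) by exact: (set_valP a).
pose lift (a : set_type A) : W := exist _ (in_whole (set_val a)) (mem_set (liftP a)).
have valc (Y : topologicalType) (D : set Y) : continuous (set_val : set_type D -> Y).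
  exact: initial_continuous.
have lc : continuous lower.
  apply: continuous_comp_initial => a.
  by apply: (@continuous_comp W (set_type [set: T]) T set_val set_val); exact: valc.
have uc : continuous lift by do 2 apply: continuous_comp_initial; exact: valc.
exists (f \o lower), (lift \o g); split.
- by move=> a; apply: continuous_comp; [exact: lc|exact: fc].
- by move=> b; apply: continuous_comp; [exact: gc|exact: uc].
- by move=> a; rewrite /= gf; do 2 apply: val_inj.
- move=> b /=; rewrite (_ : lower (lift (g b)) = g b) ?fg//; exact: val_inj.
Qed.

End WholeSpace.

Theorem theorem5p1 (R : realType) (d : nat) (d_gt0 : (0 < d)%N)
    (inclusion_order : forall C D : cone R d,
       cone_set C `<` cone_set D -> (C < D)%O) :
  (contractible R (realization R (Cones R d)) /\
   contractible R (realization R (Cones_pos R d)) /\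
   contractible R (realization R (Cones_pos R d `\ zero_cone R d))) /\
  (exists F : set (set (realization R (Cones R d `\ zero_cone R d))),
     filtered_union F /\
     forall X, F X ->
       exists A : set (set_type X),
         homeomorphic (set_type A) (set_type (unit_sphere R d)) /\
         strong_deformation_retract R A).
Proof.
split; [split; [|split]|].
- exact: contractible_minimum.
- by apply: contractible_minimum => //; exact: zero_cone_pos.
- exact: contractible_positive.
exists [set setT]; split; first exact: filtered_union_whole.
move=> _ ->; exists (set_val @^-1` closed_simplex (@orthants R d)); split.
  have [x0 _] : exists x : realization R (@nonzero R d), True.
    have [|x _] := @vertex_exists R _ _ (@nonzero R d) (ray R d_gt0); last by exists x.
    by have /positive_nonzero[] := raised_positive d_gt0 (@zero_cone_pos R d).
  exact/homeomorphic_whole/(orthants_sphere inclusion_order x0).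
exact/deforms_whole/(deforms_orthants inclusion_order).
Qed.
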